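(* Let $n\in\mathbb{N}$, $n\ge 1$, and let $\alpha, A_+, A_-, A_\Lambda$ be positive constants. Let $m$ be the model of histograms defined on a fixed finite partition $\Lambda_m$ of $\mathcal{Z}$, and denote by $D_m$ the cardinality of $\Lambda_m$. Assume that $1<D_m\le A_+ \, n/\ln(n+1)\le n$ and $$0<A_\Lambda\le D_m\inf_{I\in\Lambda_m}P(I).$$ If $(\alpha+1)A_+/A_\Lambda\le\tau:=\sqrt3-\sqrt2$ (so $\tau<0.32$), then there exists a positive constant $A_0$, depending only on $\alpha, A_+$ and $A_\Lambda$, such that, setting $$\varepsilon_n^+(m)=\max\left\{\sqrt{\frac{D_m\ln(n+1)}{n}};\ \sqrt{\frac{\ln(n+1)}{D_m}};\ \frac{\ln(n+1)}{D_m}\right\},\qquad \varepsilon_n^-(m)=\max\left\{\sqrt{\frac{D_m\ln(n+1)}{n}};\ \sqrt{\frac{\ln(n+1)}{D_m}}\right\},$$ we have, on an event of probability at least $1-4(n+1)^{-\alpha}$, $$\left(1-A_0\varepsilon_n^-(m)\right)\frac{D_m}{2n}\le\mathcal{K}(f_m,\hat f_m)\le\left(1+A_0\varepsilon_n^+(m)\right)\frac{D_m}{2n}$$ and $$\left(1-A_0\varepsilon_n^-(m)\right)\frac{D_m}{2n}\le\mathcal{K}(\hat f_m,f_m)\le\left(1+A_0\varepsilon_n^+(m)\right)\frac{D_m}{2n}.$$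
   Context: $(\mathcal{Z},\mathcal{T})$ is a measurable space, $\mu$ a known probability measure on it, and $\xi_1,\dots,\xi_n$ are i.i.d. with unknown law $P$ on $(\mathcal{Z},\mathcal{T})$ admitting a density $f_*=dP/d\mu$. $P_n=\frac1n\sum_{i=1}^n\delta_{\xi_i}$ is the empirical measure. For measurable $f$, $Pf=P(f)=\int f\,dP$ and $P_nf=\frac1n\sum_i f(\xi_i)$. Set $\mathcal{S}=\{f:\mathcal{Z}\to\mathbb{R}_+;\ \int f\,d\mu=1,\ P(\ln f)_+<\infty\}$ (conventions $\ln 0=-\infty$, $0\ln0=0$, $x_+=\max(x,0)$); it is assumed that $f_*\in\mathcal{S}$. For densities $f,g$ with respect to $\mu$, the Kullback-Leibler divergence is $\mathcal{K}(f,g)=\int f\ln(f/g)\,d\mu$ if $f\,d\mu\ll g\,d\mu$, and $+\infty$ otherwise. For a finite partition $\Lambda_m$ of $\mathcal{Z}$ into measurable sets $I$ with $\mu(I)>0$, the histogram model is $m=\{f=\sum_{I\in\Lambda_m}\beta_I\mathbf{1}_I;\ \beta_I\ge0,\ \sum_{I}\beta_I\mu(I)=1\}$. The Kullback-Leibler projection of $f_*$ onto $m$ and the maximum likelihood estimator on $m$ are respectively $$f_m=\sum_{I\in\Lambda_m}\frac{P(I)}{\mu(I)}\mathbf{1}_I,\qquad \hat f_m=\sum_{I\in\Lambda_m}\frac{P_n(I)}{\mu(I)}\mathbf{1}_I .$$ *)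

(* Defs.v *)
From mathcomp Require Export all_boot all_order all_algebra.
From mathcomp Require Export all_classical all_reals all_analysis.
Export Order.TTheory GRing.Theory Num.Theory.
Export numFieldNormedType.Exports.

Set Implicit Arguments.
Unset Strict Implicit.
Unset Printing Implicit Defensive.

Global Open Scope classical_set_scope.
Global Open Scope ring_scope.

Section Densities.
Context (d : measure_display) (Z : measurableType d) (R : realType).
Implicit Types (mu P : probability Z R) (f g : Z -> R).

Definition density_measure mu f : set Z -> \bar R :=
  fun A => (\int[mu]_(x in A) (f x)%:E)%E.

(* [lne] is the extended logarithm, with lne 0 = -oo. *)
Definition densities_S mu P : set (Z -> R) :=
  [set f : Z -> R | [/\ measurable_fun [set: Z] f,
               forall x, 0 <= f x,
               (\int[mu]_x (f x)%:E = 1)%E &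
               (\int[P]_x maxe (lne (f x)%:E) 0 < +oo)%E]].

(* Where f x = 0 the integrand is 0, whatever [ln] and division return there,
   as the convention 0 ln 0 = 0 requires; where g x = 0 < f x its value is
   irrelevant, since f dmu << g dmu makes this set f dmu-null, hence mu-null. *)
Definition KL mu f g : \bar R :=
  if `[< density_measure mu f `<< density_measure mu g >]
  then (\int[mu]_x (f x * ln (f x / g x))%:E)%E
  else +oo%E.

End Densities.

Section Sampling.
Context (dO d : measure_display) (Omega : measurableType dO)
  (Z : measurableType d) (R : realType).

Definition mutually_independent (Pr : probability Omega R) n
    (xi : 'I_n -> {mfun Omega >-> Z}) : Prop :=
  forall (J : {set 'I_n}) (B : 'I_n -> set Z),
    (forall i, measurable (B i)) ->
    Pr (\bigcap_(i in [set` J]) (xi i @^-1` B i)) =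
    (\prod_(i in J) Pr (xi i @^-1` B i))%E.

Definition iid_sample (Pr : probability Omega R) (P : probability Z R) n
    (xi : 'I_n -> {mfun Omega >-> Z}) : Prop :=
  mutually_independent Pr xi /\
  forall i A, measurable A -> distribution Pr (xi i) A = P A.

End Sampling.

Section Histograms.
Context (d : measure_display) (Z : measurableType d) (R : realType).
Implicit Types (mu P : probability Z R).

(* The cells are indexed by 'I_D: being nonempty and pairwise disjoint they are
   distinct, so D is the cardinality of the partition. *)
Definition histogram_partition mu D (Lam : 'I_D -> set Z) : Prop :=
  [/\ partition [set: 'I_D] Lam [set: Z],
      forall i, measurable (Lam i) &
      forall i, (0 < mu (Lam i))%E].

Definition histogram D (Lam : 'I_D -> set Z) (beta : 'I_D -> R) : Z -> R :=
  fun x => \sum_(i < D) beta i * \1_(Lam i) x.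

Definition histogram_of mu D (Lam : 'I_D -> set Z) (nu : set Z -> \bar R) :
    Z -> R :=
  histogram Lam (fun i => fine (nu (Lam i)) / fine (mu (Lam i))).

Definition empirical_measure n (z : 'I_n -> Z) : set Z -> \bar R :=
  fun A => ((n%:R^-1)%:E * \sum_(i < n) \d_(z i) A)%E.

Definition KL_projection mu P D (Lam : 'I_D -> set Z) : Z -> R :=
  histogram_of mu Lam P.

Definition histogram_MLE mu n (z : 'I_n -> Z) D (Lam : 'I_D -> set Z) :
    Z -> R :=
  histogram_of mu Lam (empirical_measure z).

End Histograms.

Section Rates.
Context (R : realType).

Definition eps_minus (n D : nat) : R :=
  Num.max (Num.sqrt (D%:R * ln n.+1%:R / n%:R))
          (Num.sqrt (ln n.+1%:R / D%:R)).

Definition eps_plus (n D : nat) : R :=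
  Num.max (Num.sqrt (D%:R * ln n.+1%:R / n%:R))
          (Num.max (Num.sqrt (ln n.+1%:R / D%:R)) (ln n.+1%:R / D%:R)).

End Rates.

(* Main.v *)
Require Import Defs.
From mathcomp Require Import measurable_realfun ring lra.

(** Write [p i] for the probability of the cell [i], [N i] for the number of
    observations in it, [lam i = n * p i] and [r i = N i / lam i - 1]. As soon as no
    cell is empty, the two divergences are
      [\sum_i p i * (r i - ln (1 + r i))]  and
      [\sum_i p i * ((1 + r i) * ln (1 + r i) - r i)],
    and both summands are [p i * r i ^+ 2 / 2] up to [O(p i * `|r i| ^+ 3)]. Both
    divergences are therefore [T / (2 * n)], where
    [T = \sum_i (N i - lam i) ^+ 2 / lam i] is Pearson's statistic, up to a relative
    error of the order of the largest [`|r i|] ([KL_pq_chi2], [KL_qp_chi2]). It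
    remains to show, outside an event of probability [4 * n.+1 `^ (- alpha)], that
    the [r i] are small and that [T] is close to [D] ([atypical_prob]).

    The deviations [r i] are controlled by Chernoff bounds for binomial counts
    ([occ_lower_tail], [occ_upper_tail]) at the level [(alpha + 1) * ln n.+1], and a
    union bound over the [D <= n] cells. The condition on
    [(alpha + 1) * Aplus / ALam] ensures that this level is at most [9 / 25] times any
    [lam i], which keeps every [1 + r i] above [1 / 10]. Since
    [lam i >= n * ALam / D], the [r i] are of order [sqrt (D * ln n.+1 / n)].

    The summands of [T] are dependent. But the counts are distributed as independent
    Poisson variables conditioned on an event of probability at least [1 / (e * n)],
    so the mean of a nonnegative product of functions of the counts is at most
    [e * n] times the product of its Poisson means ([poissonization]). The factor
    [e * n] only changes the constants, since the deviations are taken at a level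
    proportional to [ln n.+1]. For a Poisson count the summand of [T] has mean 1 and
    a bounded second moment, which gives the lower tail ([pearson_lower_tail]);
    restricted to [`|r i| <= 2] it has a finite exponential moment, which gives
    Bernstein's upper tail ([pearson_upper_tail]). The relative deviations of [T]
    are thus of order [sqrt (ln n.+1 / D)], and [ln n.+1 / D] in addition for the
    upper one.

    Only the cells of the observations matter: their joint law is carried by the
    finite type of maps from observations to cells, called configurations below, and
    all probabilities and means are finite sums over it until the last step. *)

Set Implicit Arguments.
Unset Strict Implicit.
Unset Printing Implicit Defensive.

(** * Elementary bounds for the exponential and the logarithm *)

Section ExpBounds.
Variable R : realType.
Implicit Types s y : R.

Lemma expRN_le_inv y : 0 <= y -> expR (- y) <= (1 + y)^-1.
Proof.
move=> y0; rewrite expRN lef_pV2 ?posrE ?expR_gt0 ?expR_ge1Dx //; lra.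
Qed.

Lemma expR_le_quad s : s <= 2^-1 -> expR s <= 1 + s + 2 * s ^+ 2.
Proof.
move=> hs; have s1 : 0 < 1 - s by lra.
have es : expR s <= (1 - s)^-1.
  rewrite -[s in expR s]opprK expRN lef_pV2 ?posrE ?expR_gt0 //.
  by have := expR_ge1Dx (- s); lra.
apply: (le_trans es); rewrite -div1r ler_pdivrMr //; nra.
Qed.

Lemma expRN_le_quad y : 0 <= y -> expR (- y) <= 1 - y + y ^+ 2.
Proof.
move=> y0; apply: (le_trans (expRN_le_inv y0)).
by rewrite -div1r ler_pdivrMr; nra.
Qed.

Lemma expR_le_remainder y : 0 <= y -> expR y <= 1 + y + y ^+ 2 * expR y.
Proof.
move=> y0; have e0 := expR_gt0 y.
have e1 : expR y - 1 <= y * expR y.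
  have := expR_ge1Dx (- y); rewrite expRN => h.
  have : (1 - y) * expR y <= (expR y)^-1 * expR y by rewrite ler_pM2r //; lra.
  by rewrite mulVf ?gt_eqF //; lra.
by have := ler_wpM2l y0 e1; nra.
Qed.

Lemma sqr_le_expR y : 0 <= y -> y ^+ 2 <= 2 * expR y.
Proof.
move=> y0; have := expR_ge1Dxn 1 y0.
rewrite (_ : 2`!%:R = 2 :> R) //; lra.
Qed.

End ExpBounds.

Section LogBounds.
Variable R : realType.
Implicit Types r a b : R.

Lemma ge0_derive_endpoints_le (f f' : R -> R) a b : a <= b ->
  (forall x, a <= x <= b -> is_derive x 1 f (f' x)) ->
  (forall x, a <= x <= b -> 0 <= f' x) -> f a <= f b.
Proof.
move=> ab df f'0.
have oc x : x \in `]a, b[ -> a <= x <= b.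
  by rewrite in_itv /= => /andP[/ltW -> /ltW ->].
apply: (@ger0_derive1_ndecr _ f a b) => //.
- by move=> x /oc xab; have [] := df x xab.
- move=> x /oc xab; rewrite derive1E.
  by have [_ ->] := df x xab; apply: f'0.
- apply: derivable_within_continuous => x; rewrite in_itv /= => xab.
  by have [] := df x xab.
Qed.

Lemma is_derive_ln1D r : -1 < r ->
  is_derive r 1 (fun x : R => ln (1 + x)) (1 + r)^-1.
Proof.
move=> r1; have r0 : 0 < 1 + r by lra.
have dln := is_derive1_ln r0.
have dsh : is_derive r 1 (fun x : R => 1 + x) 1.
  have := is_deriveD (is_derive_cst (1 : R) r 1) (is_derive_id r 1).
  by rewrite add0r.
have := is_derive1_comp (f := @ln R) (g := fun x : R => 1 + x) dln dsh.
by rewrite mulr1.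
Qed.

(** The derivative of [r - ln (1 + r) - r ^+ 2 / 2] is [- r ^+ 2 / (1 + r)], which
    lies between [- 12 * r ^+ 2] and 0 as long as [1 + r >= 1 / 10]: the function
    is nonincreasing, becomes nondecreasing after adding [4 * r ^+ 3], and both
    functions vanish at 0. *)
Lemma phi_remainder r : - (9 / 10) <= r ->
  `|(r - ln (1 + r)) - r ^+ 2 / 2| <= 4 * `|r| ^+ 3.
Proof.
move=> hr.
pose h x : R := x - ln (1 + x) - x ^+ 2 / 2.
have dh (x : R) : - (9 / 10) <= x -> is_derive x 1 h (1 - (1 + x)^-1 - x).
  move=> hx; have x1 : -1 < x by lra.
  have dl := is_derive_ln1D x1.
  rewrite /h; apply: is_derive_eq.
  rewrite !scaler0 add0r /GRing.scale /= !mulr1; lra.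
have dk (x : R) : - (9 / 10) <= x ->
    is_derive x 1 (fun y => h y + 4 * y ^+ 3) (1 - (1 + x)^-1 - x + 12 * x ^+ 2).
  move=> hx; have dhx := dh x hx.
  apply: is_derive_eq; rewrite /GRing.scale /= !mulr1; ring.
have h0 : h 0 = 0 by rewrite /h addr0 ln1 expr0n /= mul0r !subr0.
have sgn (x : R) : - (9 / 10) <= x -> 0 <= - (1 - (1 + x)^-1 - x) <= 12 * x ^+ 2.
  move=> hx; have x1 : 0 < 1 + x by lra.
  have -> : - (1 - (1 + x)^-1 - x) = x ^+ 2 / (1 + x) by field; rewrite gt_eqF.
  rewrite divr_ge0 ?sqr_ge0 ?(ltW x1) //= ler_pdivrMr //; nra.
have mono (a b : R) : - (9 / 10) <= a -> a <= b -> h b <= h a /\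
    h a + 4 * a ^+ 3 <= h b + 4 * b ^+ 3.
  move=> ha ab; split.
    rewrite -lerN2; apply: (@ge0_derive_endpoints_le (fun x => - h x)
      (fun x => - (1 - (1 + x)^-1 - x)) _ _ ab) => x /andP[ax xb].
      by have dhx := dh x (le_trans ha ax); apply: is_deriveN.
    by have /andP[] := sgn x (le_trans ha ax).
  apply: (@ge0_derive_endpoints_le (fun y => h y + 4 * y ^+ 3)
      (fun x => 1 - (1 + x)^-1 - x + 12 * x ^+ 2) _ _ ab) => x /andP[ax xb].
    exact: dk (le_trans ha ax).
  by have /andP[] := sgn x (le_trans ha ax); lra.
rewrite -/(h r).
have [r0|r0] := leP 0 r.
  have [] := mono 0 r _ r0; first by lra.
  rewrite h0 (ger0_norm r0) expr0n /= mulr0 addr0 ler_norml; lra.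
have [] := mono r 0 hr (ltW r0).
rewrite h0 (ltr0_norm r0) expr0n /= mulr0 addr0 ler_norml => h1 h2.
have -> : (- r) ^+ 3 = - r ^+ 3 by ring.
lra.
Qed.

(** With [h] the remainder bounded in [phi_remainder],
    [(1 + r) * ln (1 + r) - r = r ^+ 2 / 2 - r ^+ 3 / 2 - (1 + r) * h]. *)
Lemma psi_remainder r : - (9 / 10) <= r -> r <= 2 ->
  `|((1 + r) * ln (1 + r) - r) - r ^+ 2 / 2| <= 13 * `|r| ^+ 3.
Proof.
move=> hr r2; have := phi_remainder hr.
set h := _ - _ / 2 => hh.
have -> : (1 + r) * ln (1 + r) - r - r ^+ 2 / 2 = - (r ^+ 3 / 2) - (1 + r) * h.
  by rewrite /h; field.
apply: (le_trans (ler_normB _ _)); rewrite normrN (normrM (r ^+ 3)) (normrM (1 + r)) normrX normfV.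
have -> : `|2 : R| = 2 by rewrite ger0_norm.
have -> : `|1 + r| = 1 + r by rewrite ger0_norm //; lra.
have c0 : 0 <= `|r| ^+ 3 by rewrite exprn_ge0.
have -> : 13 * `|r| ^+ 3 = `|r| ^+ 3 / 2 + (3 * (4 * `|r| ^+ 3) + `|r| ^+ 3 / 2) by field.
rewrite lerD2l; apply: (@le_trans _ _ (3 * (4 * `|r| ^+ 3))).
  by rewrite ler_pM //; lra.
lra.
Qed.

Lemma phi_ge0 r : -1 < r -> 0 <= r - ln (1 + r).
Proof. by move=> /le_ln1Dx; rewrite subr_ge0. Qed.

Lemma psi_ge0 r : -1 < r -> 0 <= (1 + r) * ln (1 + r) - r.
Proof.
move=> r1; have r0 : 0 < 1 + r by lra.
have : -1 < (1 + r)^-1 - 1 by have := invr_gt0 (1 + r); rewrite r0; lra.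
move=> /le_ln1Dx; rewrite addrC subrK lnV ?posrE // => h.
have := ler_wpM2l (ltW r0) h.
rewrite mulrBr mulfV ?gt_eqF // mulrN; lra.
Qed.

End LogBounds.

(** * Poissonization of multinomial counts *)

Section Configurations.
Variables (R : realType) (D : nat).

Definition occ n (c : {ffun 'I_n -> 'I_D}) (i : 'I_D) : nat :=
  \sum_(j < n) (c j == i).

Lemma prod_config n (p : 'I_D -> R) (c : {ffun 'I_n -> 'I_D}) :
  \prod_(j < n) p (c j) = \prod_(i < D) p i ^+ occ c i.
Proof.
rewrite /occ; under [RHS]eq_bigr => i _ do rewrite expr_sum.
rewrite exchange_big; apply: eq_bigr => j _.
rewrite (bigD1 (c j)) //= eqxx expr1 big1 ?mulr1 // => i /negbTE.
by rewrite eq_sym => ->.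
Qed.

Definition config_cons n (x : 'I_D * {ffun 'I_n -> 'I_D}) : {ffun 'I_n.+1 -> 'I_D} :=
  [ffun j => if unlift ord0 j is Some j' then x.2 j' else x.1].

Lemma config_cons_bij n : bijective (@config_cons n).
Proof.
exists (fun c : {ffun 'I_n.+1 -> 'I_D} => (c ord0, [ffun j => c (lift ord0 j)])).
  case=> a c; congr pair; first by rewrite ffunE unlift_none.
  by apply/ffunP => j; rewrite !ffunE liftK.
move=> c; apply/ffunP => j; rewrite ffunE.
by case: unliftP => [j'|] -> //=; rewrite ffunE.
Qed.

Lemma occ_cons n a (c : {ffun 'I_n -> 'I_D}) i :
  occ (config_cons (a, c)) i = ((a == i) + occ c i)%N.
Proof.
rewrite /occ big_ord_recl ffunE unlift_none; congr addn.
by apply: eq_bigr => j _; rewrite ffunE liftK.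
Qed.

Lemma deriv_prod_ord (Q : 'I_D -> {poly R}) :
  (\prod_i Q i)^`() = \sum_a \prod_i (if i == a then (Q i)^`() else Q i).
Proof.
have gen (s : seq 'I_D) : uniq s -> (\prod_(i <- s) Q i)^`() =
    \sum_(a <- s) \prod_(i <- s) (if i == a then (Q i)^`() else Q i).
  elim: s => [|b s IH] /=; first by rewrite !big_nil derivC.
  move=> /andP[bs us]; rewrite !big_cons derivM IH // eqxx; congr (_ * _ + _).
    apply: eq_big_seq => i is_; case: eqP => // ib.
    by rewrite -ib is_ in bs.
  rewrite mulr_sumr; apply: eq_big_seq => a as_.
  rewrite big_cons; case: eqP => // ba; by rewrite ba as_ in bs.
by apply: gen; rewrite index_enum_uniq.
Qed.

(** The exponential generating function of the cell counts: there are
    [n`! / \prod_i (k_i)`!] configurations with counts [k_i]. Fixing the cell [a]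
    of the first observation shifts [g a] by one, which is what differentiating
    [Q a] does to its coefficients; so the induction on [n] is the product rule for
    the derivative. The hypothesis on the [Q i] stops at order [n] because
    differentiating one factor shifts the coefficients of that factor alone. *)
Lemma sum_config_prod_occ n (g : 'I_D -> nat -> R) (Q : 'I_D -> {poly R}) :
  (forall i k, (k <= n)%N -> (Q i)`_k = g i k / k`!%:R) ->
  \sum_(c : {ffun 'I_n -> 'I_D}) \prod_i g i (occ c i) =
  n`!%:R * (\prod_i Q i)`_n.
Proof.
elim: n g Q => [|n IH] g Q hQ.
  have u : {ffun 'I_0 -> 'I_D} by apply: finfun; case.
  rewrite (big_pred1 u) => [|c]; last by apply/esym/eqP/ffunP; case.
  rewrite mul1r coef0_prod; apply: eq_bigr => i _.
  by rewrite hQ // /occ big_ord0 divr1.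
rewrite (reindex (@config_cons n)) /=; last first.
  by apply: onW_bij; exact: config_cons_bij.
rewrite -(pair_bigA _ (fun a c => \prod_i g i (occ (config_cons (a, c)) i))) /=.
have -> : n.+1`!%:R * (\prod_i Q i)`_n.+1 = n`!%:R * ((\prod_i Q i)^`())`_n.
  by rewrite coef_deriv factS natrM -mulr_natr; ring.
rewrite deriv_prod_ord coef_sum mulr_sumr; apply: eq_bigr => a _.
under eq_bigr => c _ do under eq_bigr => i _ do rewrite occ_cons.
apply: (IH (fun i k => g i ((a == i) + k)%N)) => i k kn.
rewrite eq_sym; case: eqP => [_|_].
  rewrite coef_deriv hQ // factS natrM -mulr_natr.
  have k0 : k.+1%:R != 0 :> R by rewrite pnatr_eq0.
  have f0 : k`!%:R != 0 :> R by rewrite pnatr_eq0 -lt0n fact_gt0.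
  by rewrite add1n; rewrite -[k.+1%:R]natr1 in k0 *; field; rewrite f0.
by rewrite add0n hQ // ltnW.
Qed.

Lemma coef_le_horner (q : {poly R}) n x : 0 <= x -> (forall k, 0 <= q`_k) ->
  q`_n * x ^+ n <= q.[x].
Proof.
move=> x0 q0.
have t0 k : 0 <= q`_k * x ^+ k by rewrite mulr_ge0 ?exprn_ge0.
have [nq|nq] := ltnP n (size q); last first.
  by rewrite nth_default // mul0r horner_coef sumr_ge0.
by rewrite horner_coef (bigD1 (Ordinal nq)) //= lerDl sumr_ge0.
Qed.

(** A crude Stirling bound: [n`! * (e / n) ^ n <= e * n]. The quotient of two
    consecutive left-hand sides is [e * (n / n.+1) ^ n], at most [n.+1 / n] because
    [e <= (1 + 1 / n) ^ n.+1]. *)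
Lemma fact_le n : (0 < n)%N -> n`!%:R * expR n%:R <= expR 1 * n%:R * n%:R ^+ n :> R.
Proof.
case: n => // n _; elim: n => [|n IH]; first by rewrite factS fact0 expr1 !mulr1 mul1r.
have n1 : 0 < n.+1%:R :> R by rewrite ltr0n.
have n2 : 0 < n.+2%:R :> R by rewrite ltr0n.
have key : expR 1 * n.+1%:R ^+ n.+2 <= n.+2%:R ^+ n.+2 :> R.
  have h : expR (n.+2%:R^-1) <= n.+2%:R / n.+1%:R :> R.
    have := expR_ge1Dx (- n.+2%:R^-1 : R); rewrite expRN => h.
    rewrite -[leLHS]invrK -[leRHS]invrK lef_pV2 ?posrE ?invr_gt0 ?expR_gt0 ?divr_gt0 //.
    apply: le_trans h; rewrite invf_div ler_pdivrMr // mulrDl mulNr mulVf ?gt_eqF //.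
    by rewrite -[in n.+2%:R]natr1; lra.
  have := lerXn2r n.+2 (expR_ge0 _) (divr_ge0 (ltW n2) (ltW n1)) h.
  rewrite -expRM_natl mulfV ?gt_eqF // expr_div_n ler_pdivlMr ?exprn_gt0 //.
rewrite factS natrM -(natr1 n.+1) expRD natr1.
apply: (@le_trans _ _ (n.+2%:R * expR 1 * (expR 1 * n.+1%:R * n.+1%:R ^+ n.+1))).
  have -> : n.+2%:R * n.+1`!%:R * (expR n.+1%:R * expR 1) =
            n.+2%:R * expR 1 * (n.+1`!%:R * expR n.+1%:R) :> R by ring.
  by rewrite ler_wpM2l // mulr_ge0 ?expR_ge0.
have -> : n.+2%:R * expR 1 * (expR 1 * n.+1%:R * n.+1%:R ^+ n.+1) =
  (expR 1 * n.+2%:R) * (expR 1 * n.+1%:R ^+ n.+2) :> R by rewrite (exprS _ n.+1); ring.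
by rewrite ler_wpM2l // mulr_ge0 ?expR_ge0.
Qed.

Definition poisson_weight (l : R) (k : nat) : R := expR (- l) * l ^+ k / k`!%:R.

(** Multinomial counts are independent Poisson variables of parameters [n * p i]
    conditioned on their sum being [n], an event of probability
    [n ^ n * e ^ (- n) / n`! >= 1 / (e * n)]; hence, for nonnegative functions,
    conditioning costs at most the factor [e * n]. Algebraically, the [n]-th
    coefficient of a polynomial with nonnegative coefficients is at most its value
    at [n] divided by [n ^ n]. *)
Lemma poissonization n (p : 'I_D -> R) (f : 'I_D -> nat -> R) :
  (0 < n)%N -> (forall i, 0 <= p i) -> \sum_i p i = 1 ->
  (forall i k, 0 <= f i k) ->
  \sum_(c : {ffun 'I_n -> 'I_D}) (\prod_j p (c j)) * \prod_i f i (occ c i) <=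
  expR 1 * n%:R * \prod_i \sum_(k < n.+1) poisson_weight (n%:R * p i) k * f i k.
Proof.
move=> n0 p0 p1 f0.
have nR : 0 < n%:R :> R by rewrite ltr0n.
pose g i k := p i ^+ k * f i k.
pose Q i : {poly R} := \poly_(k < n.+1) (g i k / k`!%:R).
have g0 i k : 0 <= g i k by rewrite mulr_ge0 ?exprn_ge0.
rewrite (eq_bigr (fun c : {ffun 'I_n -> 'I_D} => \prod_i g i (occ c i))); last first.
  by move=> c _; rewrite prod_config -big_split.
rewrite (@sum_config_prod_occ _ g Q) => [|i k kn]; last by rewrite coef_poly ltnS kn.
have Q0 k : 0 <= (\prod_i Q i)`_k.
  elim/big_ind: _ k => [k|q r q0 r0 k|i _ k].
  - by rewrite coef1 ler0n.
  - by rewrite coefM sumr_ge0 // => j _; rewrite mulr_ge0.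
  - by rewrite coef_poly; case: ifP => // _; rewrite divr_ge0.
have := coef_le_horner n (ltW nR) Q0; rewrite -ler_pdivlMr ?exprn_gt0 // => hc.
have hQ : (\prod_i Q i).[n%:R] = expR n%:R *
    \prod_i \sum_(k < n.+1) poisson_weight (n%:R * p i) k * f i k.
  have -> : expR n%:R = \prod_i expR (n%:R * p i) by rewrite -expR_sum -mulr_sumr p1 mulr1.
  rewrite horner_prod -big_split /=.
  apply: eq_bigr => i _; rewrite horner_poly mulr_sumr; apply: eq_bigr => k _.
  have e1 : expR (n%:R * p i) * expR (- (n%:R * p i)) = 1 by rewrite -expRD subrr expR0.
  rewrite /poisson_weight /g exprMn !mulrA e1; ring.
apply: (le_trans (ler_wpM2l _ hc)) => //.
rewrite hQ mulrA ler_pdivrMr ?exprn_gt0 // mulrA [leRHS]mulrAC.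
rewrite ler_wpM2r //.
  apply: prodr_ge0 => i _; apply: sumr_ge0 => k _; rewrite mulr_ge0 //.
  by rewrite divr_ge0 ?mulr_ge0 ?expR_ge0 ?exprn_ge0 ?mulr_ge0.
exact: fact_le.
Qed.

End Configurations.

(** * Moments of the Poisson law *)

Section PoissonMoments.
Variables (R : realType) (l : R).
Hypothesis l0 : 0 < l.
Local Notation pw := (poisson_weight l).

Lemma poisson_weight_ge0 k : 0 <= pw k.
Proof. by rewrite /poisson_weight divr_ge0 ?mulr_ge0 ?expR_ge0 ?exprn_ge0 ?ltW. Qed.

Lemma exp_partial_le (x : R) n : 0 <= x -> \sum_(k < n) x ^+ k / k`!%:R <= expR x.
Proof.
move=> x0; rewrite -(big_mkord xpredT (fun k => x ^+ k / k`!%:R)).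
apply: (@nondecreasing_cvgn_le _ (series (exp_coeff x))).
  apply/nondecreasing_seqP => k; rewrite seriesSr lerDl.
  by rewrite /exp_coeff /= divr_ge0 ?exprn_ge0.
exact: is_cvg_series_exp_coeff.
Qed.

Lemma poisson_mgf_le (th : R) n :
  \sum_(k < n) pw k * expR (th * k%:R) <= expR (l * (expR th - 1)).
Proof.
have -> : \sum_(k < n) pw k * expR (th * k%:R) =
    expR (- l) * \sum_(k < n) (l * expR th) ^+ k / k`!%:R.
  rewrite mulr_sumr; apply: eq_bigr => k _.
  rewrite /poisson_weight mulrC [th * _]mulrC expRM_natl exprMn; ring.
rewrite mulrBr mulr1 addrC expRD ler_wpM2l ?expR_ge0 //.
by apply: exp_partial_le; rewrite mulr_ge0 ?expR_ge0 ?ltW.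
Qed.

(** The factorial moment of order [j] of the Poisson law is [l ^+ j]: since
    [pw k.+1 * k.+1 = l * pw k], moments of order [j.+1] and [j] are related by a
    shift of the summation index. *)
Lemma poisson_factorial_moment j :
  series (fun k => pw k * (k ^_ j)%:R) @ \oo --> l ^+ j.
Proof.
elim: j => [|j IH].
  have : (fun m => expR (- l) * series (exp_coeff l) m) @ \oo --> expR (- l) * expR l.
    by apply: cvgM; [exact: cvg_cst|exact: is_cvg_series_exp_coeff].
  rewrite -expRD addNr expR0; apply: cvg_trans; apply: near_eq_cvg.
  near=> m; rewrite /= /series /= mulr_sumr; apply: eq_bigr => k _.
  by rewrite ffactn0 mulr1 /poisson_weight /exp_coeff /= -mulrA.
suff : (fun m => series (fun k => pw k * (k ^_ j.+1)%:R) m.+1) @ \oo --> l * l ^+ j.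
  by rewrite exprS -(cvg_shiftS (series (fun k => pw k * (k ^_ j.+1)%:R))).
have -> : (fun m => series (fun k => pw k * (k ^_ j.+1)%:R) m.+1) =
    (fun m => l * series (fun k => pw k * (k ^_ j)%:R) m).
  apply/funext => m; rewrite /= /series /= big_nat_recl // ffact0n mulr0 add0r.
  rewrite mulr_sumr; apply: eq_bigr => k _.
  rewrite ffactSS natrM /poisson_weight factS natrM exprS.
  have k0 : k.+1%:R != 0 :> R by rewrite pnatr_eq0.
  have f0 : k`!%:R != 0 :> R by rewrite pnatr_eq0 -lt0n fact_gt0.
  move: (k.+1%:R) k0 => K k0; field; rewrite f0; exact: k0.
by apply: cvgM => //; exact: cvg_cst.
Unshelve. all: end_near. Qed.

(** For a nonnegative [q], the partial sums are bounded by the full expectation,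
    which is read off the expansion of [q] on the falling factorials. *)
Lemma poisson_moment_le (q : nat -> R) (a : nat -> R) N n :
  (forall k, 0 <= q k) ->
  (forall k, q k = \sum_(j < N) a j * (k ^_ j)%:R) ->
  \sum_(k < n) pw k * q k <= \sum_(j < N) a j * l ^+ j.
Proof.
move=> q0 qE; pose u k := pw k * q k.
have cu : series u @ \oo --> \sum_(j < N) a j * l ^+ j.
  have -> : series u = (fun m => \sum_(j < N) a j * series (fun k => pw k * (k ^_ j)%:R) m).
    apply/funext => m; rewrite /series /=.
    rewrite (eq_bigr (fun j : 'I_N => \sum_(0 <= k < m) a j * (pw k * (k ^_ j)%:R))).
      rewrite exchange_big /=; apply: eq_bigr => k _.
      by rewrite /u qE mulr_sumr; apply: eq_bigr => j _; ring.
    by move=> j _; rewrite mulr_sumr.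
  apply: cvg_big => [|j _]; first exact: add_continuous.
  by apply: cvgM; [exact: cvg_cst|exact: poisson_factorial_moment].
rewrite -(big_mkord xpredT u) -(cvg_lim _ cu) //.
apply: (@nondecreasing_cvgn_le _ (series u)).
  by apply/nondecreasing_seqP => k; rewrite seriesSr lerDl mulr_ge0 ?poisson_weight_ge0.
by apply/cvg_ex; exists (\sum_(j < N) a j * l ^+ j).
Qed.

(** The contribution to Pearson's statistic of a cell with expected count [l]. *)
Definition pearson_term (k : nat) : R := (k%:R - l) ^+ 2 / l.

Lemma pearson_term_ge0 k : 0 <= pearson_term k.
Proof. by rewrite /pearson_term divr_ge0 ?sqr_ge0 ?ltW. Qed.

Lemma ffact_natrS k j : (k ^_ j.+1)%:R = (k ^_ j)%:R * (k%:R - j%:R) :> R.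
Proof.
rewrite ffactnSr natrM; have [jk|kj] := leqP j k; first by rewrite natrB.
by rewrite ffact_small // !mul0r.
Qed.

(** The first two moments of [pearson_term] under the Poisson law are 1 and
    [3 + l^-1]. *)
Lemma poisson_quad_le (a b : R) n :
  (forall y : R, 0 <= y -> 0 <= 1 + a * y + b * y ^+ 2) ->
  \sum_(k < n) pw k * (1 + a * pearson_term k + b * pearson_term k ^+ 2) <=
  1 + a + b * (3 + l^-1).
Proof.
move=> pos.
(* the coordinates of the quartic polynomial in k on the falling factorials *)
pose cf := [:: 1 + a * l + b * l ^+ 2;
  a * (1 - 2 * l) / l + b * (1 - 4 * l + 6 * l ^+ 2 - 4 * l ^+ 3) / l ^+ 2;
  a / l + b * (7 - 12 * l + 6 * l ^+ 2) / l ^+ 2;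
  b * (6 - 4 * l) / l ^+ 2; b / l ^+ 2].
have l1 : l != 0 by rewrite gt_eqF.
apply: (le_trans (@poisson_moment_le _ (fun j => cf`_j) 5 n
  (fun k => pos _ (pearson_term_ge0 k)) _)) => [k|].
  rewrite !big_ord_recl big_ord0 /= /bump /= !ffact_natrS ffactn0 /pearson_term.
  by field.
rewrite !big_ord_recl big_ord0 /= /bump /= le_eqVlt; apply/orP; left; apply/eqP.
by field.
Qed.

End PoissonMoments.

(** * Exponential moments of the Pearson term under the Poisson law *)

Section PoissonPearson.
Variables (R : realType) (l : R).
Hypothesis l0 : 0 < l.
Local Notation pw := (poisson_weight l).
Local Notation pearson := (pearson_term l).

Lemma poisson_centered_mgf_le (th : R) n : th <= 2^-1 ->
  \sum_(k < n) pw k * expR (th * (k%:R - l)) <= expR (2 * l * th ^+ 2).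
Proof.
move=> th2.
have -> : \sum_(k < n) pw k * expR (th * (k%:R - l)) =
    expR (- (th * l)) * \sum_(k < n) pw k * expR (th * k%:R).
  by rewrite mulr_sumr; apply: eq_bigr => k _; rewrite mulrBr expRD; ring.
apply: (le_trans (ler_wpM2l (expR_ge0 _) (poisson_mgf_le l0 th n))).
rewrite -expRD ler_expR.
by have := expR_le_quad th2; rewrite -(ler_pM2l l0); lra.
Qed.

(** Without truncation the exponential of the square of a Poisson variable has an
    infinite mean. On [`|k - l| <= 2 * l] Poisson tails are still Gaussian, and the
    configurations with all relative deviations at most 2 are the only ones on which
    the upper tail matters. *)
Definition truncated_exp_pearson (s : R) (k : nat) : R :=
  if `|k%:R - l| <= 2 * l then expR (s * pearson k) else 0.

Lemma truncated_exp_pearson_ge0 s k : 0 <= truncated_exp_pearson s k.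
Proof. by rewrite /truncated_exp_pearson; case: ifP => // _; exact: expR_ge0. Qed.

Lemma geometric_expR_le N : \sum_(j < N) expR (- (j%:R / 16)) <= 17 :> R.
Proof.
have q17 : expR (- (1 / 16)) <= 16 / 17 :> R.
  have h : 0 <= 1 / 16 :> R by lra.
  apply: (le_trans (expRN_le_inv h)).
  by rewrite (_ : 1 + 1 / 16 = 17 / 16 :> R) ?invf_div //; field.
have q0 : 0 <= 1 - expR (- (1 / 16)) :> R by lra.
have -> : \sum_(j < N) expR (- (j%:R / 16)) = \sum_(j < N) expR (- (1 / 16)) ^+ j :> R.
  by apply: eq_bigr => j _; rewrite -expRM_natl; congr expR; lra.
have := subrX1 (expR (- (1 / 16)) : R) N.
have : 0 <= expR (- (1 / 16)) ^+ N :> R by rewrite exprn_ge0 ?expR_ge0.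
have : 0 <= \sum_(j < N) expR (- (1 / 16)) ^+ j :> R.
  by apply: sumr_ge0 => j _; rewrite exprn_ge0 ?expR_ge0.
nra.
Qed.

(** Slicing according to the integer part [j] of the Pearson term. On the slice,
    [`|k - l| >= sqrt (j * l)], and Chernoff's bound with the exponent
    [th j = sqrt (j / l) / 4] gives it a mass of at most [2 * expR (- (j / 8))],
    which beats the integrand [expR (j.+1 / 16)]. The truncation keeps
    [j <= 4 * l], that is [th j <= 1 / 2], the range of [expR_le_quad]. *)
Lemma poisson_truncated_exp_le n :
  \sum_(k < n) pw k * truncated_exp_pearson (16^-1) k <= 40.
Proof.
have l1 : l != 0 by rewrite gt_eqF.
pose th (j : nat) : R := Num.sqrt (j%:R / l) / 4.
have th0 j : 0 <= th j by rewrite divr_ge0 ?sqrtr_ge0.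
have thE j : th j ^+ 2 = j%:R / l / 16.
  by rewrite expr_div_n sqr_sqrtr ?divr_ge0 ?(ltW l0) //; lra.
pose w (j k : nat) : R := expR ((j.+1)%:R / 16 - j%:R / 4) *
  (expR (th j * (k%:R - l)) + expR (- th j * (k%:R - l))).
have w0 j k : 0 <= w j k by rewrite mulr_ge0 ?addr_ge0 ?expR_ge0.
pose N := (Num.trunc (4 * l)).+1.
(* the j-th slice is dominated by w j, a two-sided exponential weight *)
have layer k : truncated_exp_pearson (16^-1) k <= \sum_(j < N) w j k.
  rewrite /truncated_exp_pearson; case: ifP => [kl|_]; last exact: sumr_ge0.
  have Y0 := pearson_term_ge0 l0 k.
  have Y4 : pearson k <= 4 * l.
    rewrite /pearson_term ler_pdivrMr // -real_normK ?num_real //.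
    have : `|k%:R - l| ^+ 2 <= (2 * l) ^+ 2 by rewrite lerXn2r ?nnegrE ?mulr_ge0 ?(ltW l0).
    by lra.
  have jN : (Num.trunc (pearson k) < N)%N by rewrite ltnS le_truncn.
  rewrite (bigD1 (Ordinal jN)) //=; apply: ler_wpDr; first exact: sumr_ge0.
  have /andP[] := truncn_itv Y0.
  move: (Num.trunc _) {jN} => j jY Yj.
  apply: (@le_trans _ _ (expR (j.+1%:R / 16))); first by rewrite ler_expR; lra.
  rewrite /w expRD -mulrA ler_peMr ?expR_ge0 //.
  have dev : j%:R / 4 <= th j * `|k%:R - l|.
    rewrite -(@ler_pXn2r _ 2) ?nnegrE ?mulr_ge0 ?divr_ge0 // [leRHS]exprMn thE.
    rewrite real_normK ?num_real //.
    have -> : (k%:R - l) ^+ 2 = pearson k * l by rewrite /pearson_term; field.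
    have -> : j%:R / l / 16 * (pearson k * l) = j%:R * pearson k / 16 by field.
    have : j%:R * j%:R <= j%:R * pearson k by rewrite ler_wpM2l.
    by rewrite expr_div_n; lra.
  rewrite expRN mulrC ler_pdivlMr ?expR_gt0 // mul1r.
  have [kl0|kl0] := leP 0 (k%:R - l).
    apply: (@le_trans _ _ (expR (th j * (k%:R - l)))); last first.
      by rewrite lerDl expR_ge0.
    by rewrite ler_expR -[in leRHS](ger0_norm kl0).
  apply: (@le_trans _ _ (expR (- th j * (k%:R - l)))); last first.
    by rewrite lerDr expR_ge0.
  by rewrite ler_expR mulNr -mulrN -(ltr0_norm kl0).
have layer_mean j : (j < N)%N ->
    \sum_(k < n) pw k * w j k <= 2 * expR (1 / 16) * expR (- (j%:R / 16)).
  move=> jN.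
  have j4 : j%:R <= 4 * l.
    by rewrite -truncn_ge_nat ?mulr_ge0 ?(ltW l0) // -ltnS.
  have th2 : th j <= 2^-1.
    rewrite -(@ler_pXn2r _ 2) ?nnegrE ?invr_ge0 // thE.
    have : j%:R / l <= 4 by rewrite ler_pdivrMr.
    by rewrite exprVn; lra.
  have -> : \sum_(k < n) pw k * w j k = expR (j.+1%:R / 16 - j%:R / 4) *
      (\sum_(k < n) pw k * expR (th j * (k%:R - l)) +
       \sum_(k < n) pw k * expR (- th j * (k%:R - l))).
    rewrite -big_split /= mulr_sumr; apply: eq_bigr => k _; rewrite /w; ring.
  have mg := poisson_centered_mgf_le n th2.
  have th2' : - th j <= 2^-1 by have := th0 j; lra.
  have mg' := poisson_centered_mgf_le n th2'; rewrite sqrrN in mg'.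
  apply: (@le_trans _ _ (expR (j.+1%:R / 16 - j%:R / 4) *
    (2 * expR (2 * l * th j ^+ 2)))); first by rewrite ler_wpM2l ?expR_ge0 //; lra.
  have -> : 2 * l * th j ^+ 2 = j%:R / 8 by rewrite thE; field.
  rewrite mulrCA -expRD -mulrA -expRD ler_pM2l // ler_expR -natr1; lra.
apply: (@le_trans _ _ (\sum_(k < n) pw k * \sum_(j < N) w j k)).
  by apply: ler_sum => k _; rewrite ler_wpM2l ?poisson_weight_ge0.
under eq_bigr => k _ do rewrite mulr_sumr.
rewrite exchange_big /=.
apply: (@le_trans _ _ (\sum_(j < N) 2 * expR (1 / 16) * expR (- (j%:R / 16)))).
  by apply: ler_sum => j _; exact: layer_mean.
rewrite -mulr_sumr.
have e16 : expR (1 / 16) <= 16 / 15 :> R.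
  have ee : expR (- (1 / 16)) * expR (1 / 16) = 1 :> R by rewrite -expRD addNr expR0.
  have := expR_ge1Dx (- (1 / 16) : R); have := expR_ge0 (1 / 16 : R); nra.
have g17 := geometric_expR_le N.
have e0 := expR_ge0 (1 / 16 : R).
have g0 : 0 <= \sum_(j < N) expR (- (j%:R / 16)) :> R by apply: sumr_ge0 => j _; exact: expR_ge0.
by nra.
Qed.

(** [Y ^+ 2 * expR (s * Y) <= 2048 * expR (Y / 16)] for [s <= 1 / 32], and 40 is the
    bound of [poisson_truncated_exp_le]. *)
Definition pearson_mgf_const : R := 2048 * 40.

(** The Pearson term [Y] has mean 1, and
    [expR (s * Y) <= 1 + s * Y + s ^+ 2 * Y ^+ 2 * expR (s * Y)]: sub-exponential
    concentration only needs the last term to be integrable. *)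
Lemma poisson_exp_pearson_le n (s : R) : 0 <= s -> s <= 32^-1 ->
  \sum_(k < n) pw k * truncated_exp_pearson s k <= expR (s + pearson_mgf_const * s ^+ 2).
Proof.
move=> s0 s32.
have pt k : truncated_exp_pearson s k <= (1 + s * pearson k + 0 * pearson k ^+ 2) +
    2048 * s ^+ 2 * truncated_exp_pearson (16^-1) k.
  rewrite /truncated_exp_pearson; have Y0 := pearson_term_ge0 l0 k.
  move: (pearson k) Y0 => Y Y0; case: ifP => _; last first.
    by rewrite mulr0 addr0 mul0r addr0 addr_ge0 ?mulr_ge0.
  apply: (le_trans (expR_le_remainder (mulr_ge0 s0 Y0))).
  rewrite mul0r addr0 lerD2l exprMn.
  have h32 : 0 <= Y / 32 by rewrite divr_ge0.
  have Y2 := sqr_le_expR h32.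
  have sY : expR (s * Y) <= expR (Y / 32) by rewrite ler_expR mulrC ler_wpM2l.
  have e0 := expR_ge0 (Y / 32).
  have -> : 2048 * s ^+ 2 * expR (16^-1 * Y) =
      s ^+ 2 * ((2048 * expR (Y / 32)) * expR (Y / 32)).
    rewrite -[in RHS]mulrA -expRD (_ : 16^-1 * Y = Y / 32 + Y / 32); first by ring.
    by field.
  rewrite -[leLHS]mulrA ler_wpM2l ?sqr_ge0 // ler_pM ?sqr_ge0 ?expR_ge0 //.
  by have -> : Y ^+ 2 = 1024 * (Y / 32) ^+ 2; [field|lra].
apply: (@le_trans _ _ (1 + (s + pearson_mgf_const * s ^+ 2))); last exact: expR_ge1Dx.
apply: (@le_trans _ _ (\sum_(k < n) (pw k * (1 + s * pearson k + 0 * pearson k ^+ 2) +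
    2048 * s ^+ 2 * (pw k * truncated_exp_pearson (16^-1) k)))).
  apply: ler_sum => k _; rewrite [X in _ + X]mulrCA -mulrDr.
  by rewrite ler_wpM2l ?poisson_weight_ge0.
rewrite big_split /= -mulr_sumr.
have lin : \sum_(k < n) pw k * (1 + s * pearson k + 0 * pearson k ^+ 2) <=
    1 + s + 0 * (3 + l^-1).
  by apply: poisson_quad_le => // y y0; rewrite mul0r addr0 addr_ge0 ?mulr_ge0.
have := ler_wpM2l (mulr_ge0 (ler0n R 2048) (sqr_ge0 s)) (poisson_truncated_exp_le n).
by rewrite /pearson_mgf_const; lra.
Qed.

(** Being nonnegative, the Pearson term has a sub-Gaussian lower tail with its
    second moment as variance factor; that moment is at most 4 when [l >= 1]. *)
Lemma poisson_expN_pearson_le n (s : R) : 1 <= l -> 0 <= s ->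
  \sum_(k < n) pw k * expR (- (s * pearson k)) <= expR (- s + 4 * s ^+ 2).
Proof.
move=> l1 s0.
have pt k : expR (- (s * pearson k)) <= 1 + (- s) * pearson k + s ^+ 2 * pearson k ^+ 2.
  apply: (le_trans (expRN_le_quad (mulr_ge0 s0 (pearson_term_ge0 l0 k)))).
  by rewrite exprMn mulNr.
apply: (@le_trans _ _ (1 - s + s ^+ 2 * (3 + l^-1))).
  apply: (@le_trans _ _ (\sum_(k < n)
      pw k * (1 + (- s) * pearson k + s ^+ 2 * pearson k ^+ 2))).
    by apply: ler_sum => k _; rewrite ler_wpM2l ?poisson_weight_ge0.
  by apply: poisson_quad_le => // y y0; nra.
apply: (@le_trans _ _ (1 + (- s + 4 * s ^+ 2))); last exact: expR_ge1Dx.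
have li : l^-1 <= 1 by rewrite invf_le1.
by have := ler_wpM2l (sqr_ge0 s) li; lra.
Qed.

Lemma pearson_mgf_const_ge0 : 0 <= pearson_mgf_const.
Proof. by apply: mulr_ge0; exact: ler0n. Qed.

End PoissonPearson.

(** * Chernoff bounds for the count of one cell *)

Section CellTails.
Variables (R : realType) (D n : nat) (p : 'I_D -> R).
Hypotheses (p0 : forall i, 0 <= p i) (p1 : \sum_i p i = 1).
Local Notation config := {ffun 'I_n -> 'I_D}.

Definition config_prob (B : pred config) : R := \sum_(c : config | B c) \prod_j p (c j).

Lemma markov_config (B : pred config) (F : config -> R) :
  (forall c, 0 <= F c) -> (forall c, B c -> 1 <= F c) ->
  config_prob B <= \sum_(c : config) (\prod_j p (c j)) * F c.
Proof.
move=> F0 F1; have w0 (c : config) : 0 <= \prod_j p (c j) by apply: prodr_ge0.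
rewrite [leRHS](bigID B) /= ler_wpDr ?sumr_ge0 // => [c _|].
  by rewrite mulr_ge0.
by apply: ler_sum => c Bc; rewrite ler_peMr // F1.
Qed.

Lemma config_prob_union (I : finType) (B : pred config) (C : I -> pred config) :
  (forall c, B c -> exists i, C i c) ->
  config_prob B <= \sum_i config_prob (C i).
Proof.
move=> BC; have w0 (c : config) : 0 <= \prod_j p (c j) by apply: prodr_ge0.
apply: (@le_trans _ _ (\sum_(c : config) (\prod_j p (c j)) * \sum_i (C i c)%:R)).
  apply: markov_config => [c|c /BC[i Ci]]; first by apply: sumr_ge0.
  by rewrite (bigD1 i) //= Ci lerDl sumr_ge0.
rewrite le_eqVlt; apply/orP; left; apply/eqP.
under eq_bigr => c _ do rewrite mulr_sumr.
rewrite exchange_big /=; apply: eq_bigr => i _; rewrite /config_prob [RHS]big_mkcond /=.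
by apply: eq_bigr => c _; case: (C i c); rewrite ?mulr1 ?mulr0.
Qed.

(** The count of one cell is binomial; its moment generating function is at most
    that of the Poisson law with the same mean. *)
Lemma occ_mgf_le i (s : R) :
  \sum_(c : config) (\prod_j p (c j)) * expR (s * (occ c i)%:R) <=
  expR (n%:R * p i * (expR s - 1)).
Proof.
rewrite (eq_bigr (fun c : config => \prod_j (p (c j) * expR (s * (c j == i)%:R)))); last first.
  move=> c _; rewrite big_split /=; congr (_ * _).
  by rewrite -expR_sum -mulr_sumr -natr_sum.
rewrite -(bigA_distr_bigA (fun _ a => p a * expR (s * (a == i)%:R))) /=.
rewrite prodr_const card_ord.
have -> : \sum_a p a * expR (s * (a == i)%:R) = 1 + p i * (expR s - 1).
  have rest : \sum_(a | a != i) p a = 1 - p i.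
    by rewrite -p1 [X in X - _](bigD1 i) //= addrAC subrr add0r.
  rewrite (bigD1 i) //= eqxx (eq_bigr p) => [|a /negbTE ->].
    by rewrite rest mulr1; ring.
  by rewrite mulr0 expR0 mulr1.
rewrite -mulrA expRM_natl lerXn2r ?nnegrE ?expR_ge0 ?expR_ge1Dx //.
have pi1 : p i <= 1 by rewrite -p1 (bigD1 i) //= lerDl sumr_ge0.
have := expR_ge0 s; have := p0 i; nra.
Qed.

(** Chernoff's bound with [th = v / (1 - v)], the optimal exponent once
    [expR (- th)] is replaced by [1 / (1 + th)]. The threshold [(1 - v) ^+ 2] stays
    positive up to [v = 1]: this is how a smallness condition on [v] excludes empty
    cells. *)
Lemma occ_lower_tail i (v : R) : 0 <= v -> v < 1 ->
  config_prob (fun c => (occ c i)%:R <= n%:R * p i * (1 - v) ^+ 2) <=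
  expR (- (n%:R * p i * v ^+ 2)).
Proof.
move=> v0 v1; set l := n%:R * p i.
have l0 : 0 <= l by rewrite /l mulr_ge0 ?ler0n ?p0.
have w0 : 0 < 1 - v by rewrite subr_gt0.
pose th := v / (1 - v).
have th0 : 0 <= th by rewrite /th divr_ge0 // ltW.
pose u := l * (1 - v) ^+ 2.
apply: (@le_trans _ _ (\sum_(c : config) (\prod_j p (c j)) *
    (expR (th * u) * expR (- th * (occ c i)%:R)))).
  apply: markov_config => [c|c hc]; first by rewrite mulr_ge0 ?expR_ge0.
  rewrite -expRD mulNr -mulrBr -[leLHS]expR0 ler_expR mulr_ge0 //.
  by rewrite subr_ge0; exact: hc.
under eq_bigr => c _ do rewrite mulrCA.
rewrite -mulr_sumr; apply: (le_trans (ler_wpM2l (expR_ge0 _) (occ_mgf_le i (- th)))).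
rewrite -expRD ler_expR -/l.
have eth : expR (- th) <= 1 - v.
  apply: (le_trans (expRN_le_inv th0)).
  by rewrite /th (_ : 1 + _ = (1 - v)^-1) ?invrK //; field; rewrite gt_eqF.
have thu : th * u = l * (v * (1 - v)) by rewrite /th /u; field; rewrite gt_eqF.
by rewrite thu; have := ler_wpM2l l0 eth; lra.
Qed.

(** Chernoff's bound with the exponent [3 / 4 * v], at most [1 / 2] as
    [expR_le_quad] requires. *)
Lemma occ_upper_tail i (v : R) : 0 <= v -> v <= 2 / 3 ->
  config_prob (fun c => n%:R * p i * (1 + 3 * v) <= (occ c i)%:R) <=
  expR (- (n%:R * p i * v ^+ 2)).
Proof.
move=> v0 v1; set l := n%:R * p i.
have l0 : 0 <= l by rewrite /l mulr_ge0 ?ler0n ?p0.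
pose s := 3 / 4 * v.
have s0 : 0 <= s by rewrite /s mulr_ge0.
pose u := l * (1 + 3 * v).
apply: (@le_trans _ _ (\sum_(c : config) (\prod_j p (c j)) *
    (expR (- (s * u)) * expR (s * (occ c i)%:R)))).
  apply: markov_config => [c|c hc]; first by rewrite mulr_ge0 ?expR_ge0.
  rewrite -expRD addrC -mulrBr -[leLHS]expR0 ler_expR mulr_ge0 //.
  by rewrite subr_ge0; exact: hc.
under eq_bigr => c _ do rewrite mulrCA.
rewrite -mulr_sumr; apply: (le_trans (ler_wpM2l (expR_ge0 _) (occ_mgf_le i s))).
rewrite -expRD ler_expR -/l.
have s2 : s <= 2^-1 by rewrite /s; lra.
have := ler_wpM2l l0 (expR_le_quad s2).
have : 0 <= l * v ^+ 2 by rewrite mulr_ge0 ?sqr_ge0.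
by rewrite /u /s; lra.
Qed.

End CellTails.

(** * Concentration of Pearson's statistic *)

Section PearsonConcentration.
Variables (R : realType) (D n : nat) (p : 'I_D -> R).
Hypotheses (n0 : (0 < n)%N) (D0 : (0 < D)%N).
Hypotheses (p0 : forall i, 0 < p i) (p1 : \sum_i p i = 1).
Local Notation config := {ffun 'I_n -> 'I_D}.
Local Notation lam i := (n%:R * p i).

Let p_ge0 i : 0 <= p i. Proof. exact: ltW. Qed.
Let lam_gt0 i : 0 < lam i. Proof. by rewrite mulr_gt0 ?ltr0n. Qed.

Definition pearson_stat (c : config) : R := \sum_i pearson_term (lam i) (occ c i).

(** Markov's inequality for a product over the cells, transferred to independent
    Poisson counts. *)
Lemma config_prob_poisson_le (B : pred config) (f : 'I_D -> nat -> R) (b thr : R) :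
  (forall i k, 0 <= f i k) ->
  (forall i, \sum_(k < n.+1) poisson_weight (lam i) k * f i k <= expR b) ->
  (forall c, B c -> expR thr <= \prod_i f i (occ c i)) ->
  config_prob p B <= expR 1 * n%:R * expR (D%:R * b - thr).
Proof.
move=> f0 fb fB.
apply: (@le_trans _ _ (\sum_(c : config) (\prod_j p (c j)) *
    (expR (- thr) * \prod_i f i (occ c i)))).
  apply: markov_config => // c; first by rewrite mulr_ge0 ?expR_ge0 ?prodr_ge0.
  by move=> /fB; rewrite -ler_pdivrMl ?expR_gt0 // expRN invrK mulr1.
under eq_bigr => c _ do rewrite mulrCA.
rewrite -mulr_sumr.
apply: (le_trans (ler_wpM2l (expR_ge0 _) (poissonization n0 p_ge0 p1 f0))).
rewrite mulrCA ler_wpM2l ?mulr_ge0 ?expR_ge0 // addrC expRD ler_wpM2l ?expR_ge0 //.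
apply: (@le_trans _ _ (\prod_(i < D) expR b)); last first.
  by rewrite prodr_const card_ord expRM_natl.
apply: ler_prod => i _; rewrite fb andbT; apply: sumr_ge0 => k _.
by rewrite mulr_ge0 ?poisson_weight_ge0.
Qed.

(** [s = sqrt (x / D) / 2] minimizes [4 * D * s ^+ 2 - s * y] for the deviation
    [y = 4 * sqrt (D * x)]; the minimum is [- x]. *)
Lemma pearson_lower_tail (x : R) : 0 <= x -> (forall i, 1 <= lam i) ->
  config_prob p (fun c => pearson_stat c <= D%:R - 4 * Num.sqrt (D%:R * x)) <=
  n%:R * expR (1 - x).
Proof.
move=> x0 lam1.
have DR : 0 < D%:R :> R by rewrite ltr0n.
pose s := Num.sqrt (x / D%:R) / 2.
have s0 : 0 <= s by rewrite divr_ge0 ?sqrtr_ge0.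
have sD : D%:R * s ^+ 2 = x / 4.
  rewrite expr_div_n sqr_sqrtr ?divr_ge0 ?ler0n //; field; rewrite gt_eqF //.
have sx : s * Num.sqrt (D%:R * x) = x / 2.
  rewrite mulrAC -sqrtrM ?divr_ge0 ?ler0n //.
  have -> : x / D%:R * (D%:R * x) = x ^+ 2 by field; rewrite gt_eqF.
  by rewrite sqrtr_sqr ger0_norm.
pose thr := - s * (D%:R - 4 * Num.sqrt (D%:R * x)).
apply: (le_trans (@config_prob_poisson_le _ (fun i k => expR (- (s * pearson_term (lam i) k)))
   (- s + 4 * s ^+ 2) thr _ _ _)).
- by move=> i k; exact: expR_ge0.
- by move=> i; exact: poisson_expN_pearson_le.
- move=> c hc; rewrite -expR_sum ler_expR sumrN -mulr_sumr -mulNr.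
  by rewrite ler_wnM2l ?oppr_le0.
rewrite mulrC mulrA -expRD mulrC ler_wpM2l // ler_expR /thr; lra.
Qed.

Definition upper_tail_const : R := pearson_mgf_const R + 1.

Lemma upper_tail_const_ge0 : 0 <= upper_tail_const.
Proof. by apply: addr_ge0; [exact: pearson_mgf_const_ge0|exact: ler01]. Qed.

(** The usual dichotomy of Bernstein's inequality: the exponent [sqrt (x / D)] if it
    is admissible, and the largest admissible one, [1 / 32], otherwise; the two terms
    of the deviation pay for the two cases. *)
Lemma pearson_upper_tail (x : R) : 0 <= x ->
  config_prob p (fun c =>
    [forall i, `|(occ c i)%:R - lam i| <= 2 * lam i] &&
    (D%:R + upper_tail_const * Num.sqrt (D%:R * x) + 32 * upper_tail_const * x <= pearson_stat c))
  <= n%:R * expR (1 - x).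
Proof.
move=> x0.
have DR : 0 < D%:R :> R by rewrite ltr0n.
have C0 : 0 <= pearson_mgf_const R by exact: pearson_mgf_const_ge0.
have C1 := upper_tail_const_ge0.
have q0 := sqrtr_ge0 (D%:R * x).
set y := upper_tail_const * Num.sqrt (D%:R * x) + 32 * upper_tail_const * x.
have [s /and3P[s0 s32 hs]] : exists s, [&& 0 <= s, s <= 32^-1 &
    pearson_mgf_const R * (D%:R * s ^+ 2) - s * y <= - x].
  pose t := Num.sqrt (x / D%:R).
  have t0 : 0 <= t by rewrite sqrtr_ge0.
  have tD : D%:R * t ^+ 2 = x.
    by rewrite sqr_sqrtr ?divr_ge0 ?ler0n //; field; rewrite gt_eqF.
  have tx : t * Num.sqrt (D%:R * x) = x.
    rewrite -sqrtrM ?divr_ge0 ?ler0n //.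
    have -> : x / D%:R * (D%:R * x) = x ^+ 2 by field; rewrite gt_eqF.
    by rewrite sqrtr_sqr ger0_norm.
  have [t32|t32] := leP t 32^-1.
    exists t; rewrite t0 t32 tD /=.
    have -> : t * y = upper_tail_const * (t * Num.sqrt (D%:R * x)) + 32 * upper_tail_const * x * t.
      by rewrite /y; ring.
    rewrite tx; have : 0 <= 32 * upper_tail_const * x * t.
      by rewrite !mulr_ge0.
    have -> : upper_tail_const * x = pearson_mgf_const R * x + x by rewrite /upper_tail_const; ring.
    by lra.
  exists 32^-1; rewrite invr_ge0 ler0n lexx /=.
  have Dx : D%:R * (32^-1) ^+ 2 <= x.
    by rewrite -tD ler_wpM2l ?ler0n // lerXn2r ?nnegrE ?invr_ge0 // ltW.
  have := ler_wpM2l C0 Dx.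
  have : 0 <= upper_tail_const * Num.sqrt (D%:R * x).
    by rewrite mulr_ge0.
  rewrite /y; have -> : 32 * upper_tail_const * x = 32 * (pearson_mgf_const R * x + x).
    by rewrite /upper_tail_const; ring.
  by lra.
apply: (le_trans (@config_prob_poisson_le _ (fun i => truncated_exp_pearson (lam i) s)
   (s + pearson_mgf_const R * s ^+ 2) (s * (D%:R + y)) _ _ _)).
- by move=> i k; exact: truncated_exp_pearson_ge0.
- by move=> i; exact: poisson_exp_pearson_le.
- move=> c /andP[/forallP hc]; rewrite -addrA -/y => hT.
  rewrite (eq_bigr (fun i => expR (s * pearson_term (lam i) (occ c i)))) => [|i _].
    by rewrite -expR_sum ler_expR -mulr_sumr ler_wpM2l.
  by rewrite /truncated_exp_pearson hc.
rewrite mulrC mulrA -expRD mulrC ler_wpM2l // ler_expR; lra.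
Qed.

End PearsonConcentration.

(** * Typical configurations *)

Section TypicalConfigurations.
Variables (R : realType) (D n : nat) (p : 'I_D -> R) (alpha : R).
Hypotheses (n0 : (0 < n)%N) (D0 : (0 < D)%N) (Dn : (D <= n)%N) (alpha0 : 0 < alpha).
Hypotheses (p0 : forall i, 0 < p i) (p1 : \sum_i p i = 1).
Local Notation config := {ffun 'I_n -> 'I_D}.
Local Notation lam i := (n%:R * p i).
Local Notation L := (ln n.+1%:R : R).

(** The relative deviation scale of a cell count at level [(alpha + 1) * L]; the
    additional unit in [alpha + 1] pays for the union bound over the cells. *)
Definition cell_dev (i : 'I_D) : R := Num.sqrt ((alpha + 1) * L / lam i).

Definition cells_typical (c : config) : bool := [forall i,
  (lam i * (1 - cell_dev i) ^+ 2 < (occ c i)%:R) &&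
  ((occ c i)%:R < lam i * (1 + 3 * cell_dev i))].

(** The level is [(alpha + 3) * L] because passing to independent Poisson counts
    costs a factor [e * n], itself at most [n.+1 ^ 3]. *)
Definition pearson_typical (c : config) : bool :=
  let x := (alpha + 3) * L in
  (D%:R - 4 * Num.sqrt (D%:R * x) < pearson_stat p c) &&
  (pearson_stat p c < D%:R + upper_tail_const R * Num.sqrt (D%:R * x) + 32 * upper_tail_const R * x).

Definition typical (c : config) : bool := cells_typical c && pearson_typical c.

Hypotheses (lam1 : forall i, 1 <= lam i) (dev_small : forall i, cell_dev i <= 3 / 5).

Let lam_gt0 i : 0 < lam i. Proof. by rewrite mulr_gt0 ?ltr0n. Qed.
Let L_gt0 : 0 < L. Proof. by rewrite ln_gt0 // ltr1n. Qed.
Let dev_ge0 i : 0 <= cell_dev i. Proof. exact: sqrtr_ge0. Qed.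
Let expNL : expR (- L) = n.+1%:R^-1. Proof. by rewrite expRN lnK ?posrE ?ltr0n. Qed.

Let lam_dev i : lam i * cell_dev i ^+ 2 = (alpha + 1) * L.
Proof.
rewrite sqr_sqrtr; last first.
  by rewrite divr_ge0 ?(ltW (lam_gt0 i)) // mulr_ge0 ?(ltW L_gt0) // addr_ge0 ?ltW.
by rewrite mulrC divfK // gt_eqF.
Qed.

Lemma cells_typical_near c i : cells_typical c ->
  lam i / 10 <= (occ c i)%:R /\
  `|(occ c i)%:R - lam i| <= 3 * cell_dev i * lam i.
Proof.
move=> /forallP/(_ i)/andP[lo up].
have v0 := dev_ge0 i; have v1 := dev_small i; have l0 := lam_gt0 i.
move: lo up v0 v1 l0; move: (lam i) (cell_dev i) => l v lo up v0 v1 l0.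
have lv0 : 0 <= l * v by rewrite mulr_ge0 // ltW.
have lvv : 0 <= l * v ^+ 2 by rewrite mulr_ge0 ?sqr_ge0 // ltW.
split; first by apply: ltW; apply: le_lt_trans lo; rewrite ler_pM2l //; nra.
by rewrite ler_norml; lra.
Qed.

Let tail_n : n%:R * expR (- ((alpha + 1) * L)) <= expR (- (alpha * L)).
Proof.
have -> : - ((alpha + 1) * L) = - (alpha * L) + - L by ring.
rewrite expRD expNL mulrCA ler_piMr ?expR_ge0 // ler_pdivrMr ?ltr0n // mul1r.
by rewrite ler_nat.
Qed.

Let tail_pearson : n%:R * expR (1 - (alpha + 3) * L) <= expR (- (alpha * L)).
Proof.
have e4 : expR 1 <= 4 :> R.
  have half : expR (- (1 / 2)) * expR (1 / 2) = 1 :> R by rewrite -expRD addNr expR0.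
  have -> : 1 = 1 / 2 + 1 / 2 :> R by field.
  have := expR_ge1Dx (- (1 / 2) : R); rewrite expRD.
  by have := expR_gt0 (1 / 2 : R); nra.
have -> : 1 - (alpha + 3) * L = - (alpha * L) + (1 + (- L + (- L + - L))) by ring.
rewrite !expRD expNL mulrCA ler_piMr ?expR_ge0 //.
have N0 : 0 < n.+1%:R :> R by rewrite ltr0n.
rewrite mulrCA [leLHS](_ : _ = expR 1 * n%:R / n.+1%:R ^+ 3); last first.
  by field; rewrite gt_eqF.
rewrite ler_pdivrMr ?exprn_gt0 // mul1r.
have n1 : 1 <= n%:R :> R by rewrite ler1n.
rewrite -natr1; have : expR 1 * n%:R <= 4 * n%:R :> R by rewrite ler_wpM2r.
nra.
Qed.

(** One [n.+1 `^ (- alpha)] for each of the four ways to be atypical: a cell with too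
    few or too many observations, a Pearson statistic too small, or too large while
    no cell is overfull. *)
Lemma atypical_prob :
  config_prob p (fun c => ~~ typical c) <= 4 * n.+1%:R `^ (- alpha).
Proof.
have -> : n.+1%:R `^ (- alpha) = expR (- (alpha * L)) :> R.
  by rewrite /powR pnatr_eq0 /= mulNr.
have p_ge0 i : 0 <= p i by exact: ltW.
pose x := (alpha + 3) * L.
have x0 : 0 <= x by rewrite mulr_ge0 ?(ltW L_gt0) // addr_ge0 // ltW.
pose bad (k : ('I_D + 'I_D) + bool) : pred config := match k with
  | inl (inl i) => fun c => (occ c i)%:R <= lam i * (1 - cell_dev i) ^+ 2
  | inl (inr i) => fun c => lam i * (1 + 3 * cell_dev i) <= (occ c i)%:R
  | inr true => fun c => pearson_stat p c <= D%:R - 4 * Num.sqrt (D%:R * x)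
  | inr false => fun c => [forall i, `|(occ c i)%:R - lam i| <= 2 * lam i] &&
      (D%:R + upper_tail_const R * Num.sqrt (D%:R * x) + 32 * upper_tail_const R * x
         <= pearson_stat p c)
  end.
apply: (le_trans (config_prob_union p_ge0 (C := bad) _)).
  move=> c; rewrite /typical; case cc: (cells_typical c) => /=.
    rewrite negb_and -!leNgt => /orP[h|h]; first by exists (inr true).
    exists (inr false); rewrite /= h andbT; apply/forallP => i.
    have [_] := cells_typical_near i cc; move/le_trans; apply.
    by rewrite ler_wpM2r ?(ltW (lam_gt0 i)) //; have := dev_small i; lra.
  move=> _; move/negbT: cc; rewrite negb_forall => /existsP[i].
  rewrite negb_and -!leNgt => /orP[h|h]; first by exists (inl (inl i)).
  by exists (inl (inr i)).
rewrite !big_sumType /= big_bool /=.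
have cell_sum (f : 'I_D -> R) : (forall i, f i <= expR (- ((alpha + 1) * L))) ->
    \sum_i f i <= expR (- (alpha * L)).
  move=> hf; apply: le_trans tail_n; apply: (le_trans (ler_sum _ (fun i _ => hf i))).
  rewrite sumr_const card_ord -[leLHS]mulr_natl ler_wpM2r ?expR_ge0 // ler_nat //.
have b1 : \sum_i config_prob p (bad (inl (inl i))) <= expR (- (alpha * L)).
  apply: cell_sum => i; rewrite -(lam_dev i); apply: occ_lower_tail => //.
  by have := dev_small i; lra.
have b2 : \sum_i config_prob p (bad (inl (inr i))) <= expR (- (alpha * L)).
  apply: cell_sum => i; rewrite -(lam_dev i); apply: occ_upper_tail => //.
  by have := dev_small i; lra.
have b3 : config_prob p (bad (inr true)) <= expR (- (alpha * L)).
  exact: le_trans (pearson_lower_tail n0 D0 p0 p1 x0 lam1) tail_pearson.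
have b4 : config_prob p (bad (inr false)) <= expR (- (alpha * L)).
  exact: le_trans (pearson_upper_tail n0 D0 p0 p1 x0) tail_pearson.
by move: b1 b2 b3 b4; rewrite /=; lra.
Qed.

End TypicalConfigurations.

(** * Divergences and Pearson's statistic *)

Section DiscreteKL.
Variables (R : realType) (D : nat).
Implicit Types p q : 'I_D -> R.

Definition discrete_KL p q : R := \sum_i p i * ln (p i / q i).

Definition chi2 p q : R := \sum_i (q i - p i) ^+ 2 / p i.

Variables (p q : 'I_D -> R) (dl : R).
Hypotheses (p0 : forall i, 0 < p i) (p1 : \sum_i p i = 1) (q1 : \sum_i q i = 1).
Hypotheses (q_ge : forall i, p i / 10 <= q i) (dl2 : dl <= 2).
Hypothesis q_near : forall i, `|q i - p i| <= dl * p i.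

(* With q = p * (1 + r) and \sum_i p i * r i = 0, each divergence is a sum of
   p i * f (r i) where f vanishes to second order at 0. *)
Let r i := q i / p i - 1.

Let p_neq0 i : p i != 0. Proof. by rewrite gt_eqF. Qed.

Let qE i : q i = p i * (1 + r i).
Proof. by rewrite /r; field; exact: p_neq0. Qed.

Let r_ge i : - (9 / 10) <= r i.
Proof.
have : 10^-1 <= q i / p i by rewrite ler_pdivlMr // mulrC.
by rewrite /r; lra.
Qed.

Let r_near i : `|r i| <= dl.
Proof.
have -> : r i = (q i - p i) / p i by rewrite /r; field; exact: p_neq0.
by rewrite normrM normfV (gtr0_norm (p0 i)) ler_pdivrMr.
Qed.

Let r_le2 i : r i <= 2.
Proof. by apply: le_trans (ler_norm _) (le_trans (r_near i) dl2). Qed.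

Let r_gtN1 i : -1 < r i. Proof. by have := r_ge i; lra. Qed.

Let sum_pr : \sum_i p i * r i = 0.
Proof.
rewrite (eq_bigr (fun i => q i - p i)) => [|i _]; last first.
  by rewrite (qE i); ring.
by rewrite sumrB q1 p1 subrr.
Qed.

Let KL_pqE : discrete_KL p q = \sum_i p i * (r i - ln (1 + r i)).
Proof.
under [RHS]eq_bigr do rewrite mulrBr.
rewrite sumrB sum_pr sub0r -sumrN; apply: eq_bigr => i _.
have r1 : 0 < 1 + r i by have := r_gtN1 i; lra.
rewrite -mulrN -lnV ?posrE //; congr (_ * ln _).
by rewrite (qE i); field; rewrite p_neq0 gt_eqF.
Qed.

Let KL_qpE : discrete_KL q p = \sum_i p i * ((1 + r i) * ln (1 + r i) - r i).
Proof.
under [RHS]eq_bigr do rewrite mulrBr.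
rewrite sumrB sum_pr subr0; apply: eq_bigr => i _.
rewrite mulrA -qE; congr (_ * ln _).
by rewrite (qE i); field; exact: p_neq0.
Qed.

Let chi2E : chi2 p q = \sum_i p i * r i ^+ 2.
Proof.
by apply: eq_bigr => i _; rewrite /r; field; exact: p_neq0.
Qed.

Let remainder (f : R -> R) :
  (forall s, - (9 / 10) <= s -> s <= 2 -> `|f s - s ^+ 2 / 2| <= 13 * `|s| ^+ 3) ->
  `|\sum_i p i * f (r i) - chi2 p q / 2| <= 13 * dl * chi2 p q.
Proof.
move=> hf; rewrite chi2E mulr_suml -sumrB mulr_sumr.
apply: (le_trans (ler_norm_sum _ _ _)); apply: ler_sum => i _.
have -> : p i * f (r i) - p i * r i ^+ 2 / 2 = p i * (f (r i) - r i ^+ 2 / 2) by ring.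
rewrite normrM (gtr0_norm (p0 i)) mulrCA ler_pM2l //.
apply: (le_trans (hf _ (r_ge i) (r_le2 i))).
rewrite -mulrA ler_wpM2l // exprS real_normK ?num_real //.
by rewrite ler_wpM2r ?sqr_ge0.
Qed.

Lemma KL_pq_chi2 : `|discrete_KL p q - chi2 p q / 2| <= 13 * dl * chi2 p q.
Proof.
rewrite KL_pqE; apply: (remainder (f := fun s => s - ln (1 + s))) => s s9 _.
apply: (le_trans (phi_remainder s9)); rewrite ler_wpM2r ?exprn_ge0 //.
by rewrite ler_nat.
Qed.

Lemma KL_qp_chi2 : `|discrete_KL q p - chi2 p q / 2| <= 13 * dl * chi2 p q.
Proof.
by rewrite KL_qpE; apply: (remainder (f := fun s => (1 + s) * ln (1 + s) - s)) => s;
  exact: psi_remainder.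
Qed.

Lemma KL_pq_ge0 : 0 <= discrete_KL p q.
Proof. by rewrite KL_pqE; apply: sumr_ge0 => i _; rewrite mulr_ge0 ?(ltW (p0 i)) ?phi_ge0. Qed.

Lemma KL_qp_ge0 : 0 <= discrete_KL q p.
Proof. by rewrite KL_qpE; apply: sumr_ge0 => i _; rewrite mulr_ge0 ?(ltW (p0 i)) ?psi_ge0. Qed.

End DiscreteKL.

Section Sandwich.
Variable R : realType.

(** A divergence equal to [X / 2] up to a relative error [26 * dl], where [X / 2] is
    itself close to [m]. The lower bound is trivial once [A0 * em >= 1], because the
    divergence is nonnegative; otherwise all the factors [1 - _] are nonnegative and
    can be multiplied. For the upper bound, [dl <= 2] absorbs the product of the two
    errors. *)
Lemma KL_sandwich (K X dl em ep a b A0 m : R) :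
  0 <= m -> 0 <= K -> 0 <= dl -> dl <= 2 -> 0 <= a -> 0 <= b -> 0 <= em -> em <= ep ->
  dl <= a * em -> A0 = 26 * a + 53 * b ->
  `|K - X / 2| <= 13 * dl * X ->
  (1 - b * em) * m <= X / 2 -> X / 2 <= (1 + b * ep) * m ->
  (1 - A0 * em) * m <= K /\ K <= (1 + A0 * ep) * m.
Proof.
move=> m0 K0 dl0 dl2 a0 b0 em0 eme dla A0E; rewrite ler_norml => /andP[Klo Kup] Xlo Xup.
have ep0 := le_trans em0 eme.
have bp0 : 0 <= b * ep by rewrite mulr_ge0.
have bm0 : 0 <= b * em by rewrite mulr_ge0.
have am0 : 0 <= a * em by rewrite mulr_ge0.
have dlap : dl <= a * ep by apply: le_trans dla _; rewrite ler_wpM2l.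
split; last first.
  apply: (@le_trans _ _ (X / 2 * (1 + 26 * dl))); first by lra.
  apply: (@le_trans _ _ ((1 + b * ep) * m * (1 + 26 * dl))).
    by rewrite ler_wpM2r // addr_ge0 // mulr_ge0.
  rewrite mulrAC ler_wpM2r // A0E.
  have : b * ep * dl <= b * ep * 2 by rewrite ler_wpM2l.
  by lra.
have [big|small] := leP 1 (A0 * em).
  by apply: le_trans K0; rewrite mulr_le0_ge0 // subr_le0.
have s1 : 0 <= 1 - b * em by move: small; rewrite A0E; lra.
have s2 : 0 <= 1 - 26 * (a * em) by move: small; rewrite A0E; lra.
apply: (@le_trans _ _ ((1 - b * em) * m * (1 - 26 * (a * em)))).
  rewrite mulrAC ler_wpM2r // A0E.
  have : 0 <= (b * em) * (a * em) by rewrite mulr_ge0.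
  by lra.
apply: (@le_trans _ _ (X / 2 * (1 - 26 * (a * em)))); first by rewrite ler_wpM2r.
have X0 : 0 <= X / 2 by apply: le_trans Xlo; rewrite mulr_ge0.
apply: (@le_trans _ _ (X / 2 * (1 - 26 * dl))); last by lra.
by rewrite ler_wpM2l //; lra.
Qed.

End Sandwich.

(** * Divergences between histograms *)

Section HistogramKL.
Context (d : measure_display) (Z : measurableType d) (R : realType).
Variables (mu : probability Z R) (D : nat) (Lam : 'I_D -> set Z).
Hypothesis hLam : histogram_partition mu Lam.
Implicit Types a b : 'I_D -> R.

Let mLam i : measurable (Lam i). Proof. by have [_] := hLam. Qed.

Lemma partition_cell x : exists i, Lam i x.
Proof.
have [[cov _ _] _ _] := hLam.
have : [set: Z] x by [].
by rewrite -cov => -[i _ Lix]; exists i.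
Qed.

Lemma partition_uniq i j x : Lam i x -> Lam j x -> i = j.
Proof.
have [[_ tri _] _ _] := hLam => hi hj.
by apply: tri => //; exists x.
Qed.

Lemma mem_partition i j x : Lam i x -> (x \in Lam j) = (i == j).
Proof.
move=> hi; apply/idP/eqP => [|<-]; last by rewrite inE.
by rewrite inE; exact: partition_uniq.
Qed.

Lemma histogram_cell a i x : Lam i x -> histogram Lam a x = a i.
Proof.
move=> hi; rewrite /histogram (bigD1 i) //= indicE (mem_partition _ hi) eqxx mulr1.
rewrite big1 ?addr0 // => j ji.
by rewrite indicE (mem_partition _ hi) eq_sym (negbTE ji) mulr0.
Qed.

Lemma measurable_histogram a : measurable_fun [set: Z] (histogram Lam a).
Proof.
by apply: measurable_sum => i; apply: measurable_funM.
Qed.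

Lemma integral_histogram a :
  (\int[mu]_x (histogram Lam a x)%:E = (\sum_i a i * fine (mu (Lam i)))%:E)%E.
Proof.
have intI i : mu.-integrable [set: Z] (EFin \o \1_(Lam i)).
  exact: integrable_indic.
under eq_integral => x _ do rewrite /histogram -sumEFin.
rewrite integral_sum //; last first.
  move=> i; have := integrableZl measurableT (a i) (intI i).
  by apply: eq_integrable => // x _; rewrite EFinM.
rewrite -sumEFin; apply: eq_bigr => i _.
under eq_integral => x _ do rewrite EFinM.
rewrite (integralZl measurableT (intI i)) integral_indic // setIT EFinM fineK //.
exact: fin_num_measure.
Qed.

(** Positive histograms on the same partition are bounded by multiples of each other,
    so that the condition of absolute continuity holds. *)
Lemma KL_histogram a b : (forall i, 0 < a i) -> (forall i, 0 < b i) ->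
  KL mu (histogram Lam a) (histogram Lam b) =
  (\sum_i a i * ln (a i / b i) * fine (mu (Lam i)))%:E.
Proof.
move=> a0 b0.
have dom : density_measure mu (histogram Lam a) `<< density_measure mu (histogram Lam b).
  pose C := \sum_i a i / b i.
  have ab0 i : 0 <= a i / b i by rewrite divr_ge0 ?ltW.
  have C0 : 0 <= C by apply: sumr_ge0.
  have hist0 (c : 'I_D -> R) x : (forall i, 0 < c i) -> (0 <= (histogram Lam c x)%:E)%E.
    by move=> c0; have [i hi] := partition_cell x; rewrite (histogram_cell _ hi) lee_fin ltW.
  have aCb x : histogram Lam a x <= C * histogram Lam b x.
    have [i hi] := partition_cell x; rewrite !(histogram_cell _ hi).
    rewrite -ler_pdivrMr // /C (bigD1 i) //= lerDl sumr_ge0 //.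
  move=> N /= hN A mA AN; apply/eqP; rewrite eq_le; apply/andP; split; last first.
    by apply: integral_ge0 => x _; exact: hist0.
  have mh (c : 'I_D -> R) : measurable_fun A (EFin \o histogram Lam c).
    by apply/measurable_EFinP; apply: measurable_funTS; exact: measurable_histogram.
  have := hN A mA AN; rewrite /density_measure => h0.
  apply: (@le_trans _ _ (\int[mu]_(x in A) (C%:E * (histogram Lam b x)%:E))%E).
    apply: ge0_le_integral => //.
    - by move=> x _; exact: hist0.
    - exact: mh.
    - exact: measurable_funeM (mh b).
    - by move=> x _; rewrite -EFinM lee_fin.
  rewrite ge0_integralZl //; last by move=> x _; exact: hist0.
    by rewrite h0 mule0.
  exact: mh.
rewrite /KL asboolT // -(integral_histogram (fun i => a i * ln (a i / b i))).
apply: eq_integral => x _; have [i hi] := partition_cell x.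
by rewrite !(histogram_cell _ hi).
Qed.

Let mu_fine_gt0 i : 0 < fine (mu (Lam i)).
Proof.
have [_ _ mu0] := hLam.
by rewrite fine_gt0 // mu0 ltey_eq fin_num_measure.
Qed.

Lemma KL_histogram_of (nu1 nu2 : set Z -> \bar R) (p q : 'I_D -> R) :
  (forall i, fine (nu1 (Lam i)) = p i) -> (forall i, fine (nu2 (Lam i)) = q i) ->
  (forall i, 0 < p i) -> (forall i, 0 < q i) ->
  KL mu (histogram_of mu Lam nu1) (histogram_of mu Lam nu2) = (discrete_KL p q)%:E.
Proof.
move=> nu1E nu2E p0 q0; rewrite KL_histogram; last first.
- by move=> i; rewrite nu2E divr_gt0.
- by move=> i; rewrite nu1E divr_gt0.
congr EFin; apply: eq_bigr => i _; rewrite nu1E nu2E.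
have m0 := mu_fine_gt0 i.
have -> : p i / fine (mu (Lam i)) / (q i / fine (mu (Lam i))) = p i / q i.
  by field; rewrite !gt_eqF.
by rewrite mulrAC divfK // gt_eqF.
Qed.

End HistogramKL.

(** * From configurations to events of the sample space *)

Section SampleConfigurations.
Context (dO d : measure_display) (Omega : measurableType dO)
  (Z : measurableType d) (R : realType).
Variables (mu P : probability Z R) (Pr : probability Omega R).
Variables (n : nat) (xi : 'I_n -> {mfun Omega >-> Z}) (hxi : iid_sample Pr P xi).
Variables (D : nat) (Lam : 'I_D -> set Z) (hLam : histogram_partition mu Lam).
Local Notation config := {ffun 'I_n -> 'I_D}.

Definition config_event (c : config) : set Omega :=
  \bigcap_(j in [set` [set: 'I_n]%SET]) (xi j @^-1` Lam (c j)).

Let mLam i : measurable (Lam i). Proof. by have [_] := hLam. Qed.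

Lemma measurable_config_event c : measurable (config_event c).
Proof.
rewrite /config_event; apply: fin_bigcap_measurable => [|j _]; first exact: finite_finset.
by rewrite -[X in measurable X]setTI; exact: measurable_funP.
Qed.

Lemma config_event_prob c :
  Pr (config_event c) = (\prod_j fine (P (Lam (c j))))%:E.
Proof.
have [ind law] := hxi.
rewrite /config_event (ind _ (fun j => Lam (c j))) // -prodEFin.
apply: eq_big => j; first by rewrite inE.
move=> _; rewrite fineK ?fin_num_measure //; exact: (law j).
Qed.

Definition configs_event (B : pred config) : set Omega :=
  \big[setU/set0]_(c | B c) config_event c.

Lemma measurable_configs_event B : measurable (configs_event B).
Proof. by apply: bigsetU_measurable => c _; exact: measurable_config_event. Qed.

Lemma configs_eventP B w : configs_event B w -> exists2 c, B c & config_event c w.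
Proof.
rewrite /configs_event; elim/big_rec: _ => // c E Bc IH [] //; first by exists c.
Qed.

Lemma config_event_cover w : exists c, config_event c w.
Proof.
have ex j : exists i, Lam i (xi j w) by exact: partition_cell hLam _.
exists [ffun j => sval (cid (ex j))] => j _; rewrite /= ffunE.
exact: svalP (cid (ex j)).
Qed.

Lemma configs_event_ge B :
  ((1 - config_prob (fun i => fine (P (Lam i))) (fun c => ~~ B c))%:E
     <= Pr (configs_event B))%E.
Proof.
have cover : configs_event B `|` configs_event (fun c => ~~ B c) = setT.
  apply/seteqP; split => // w _; have [c hc] := config_event_cover w.
  have [Bc|Bc] := boolP (B c); [left|right];
    by rewrite /configs_event (bigD1 c) //=; left.
have le_sum (A : pred config) :
    (Pr (configs_event A) <= (config_prob (fun i => fine (P (Lam i))) A)%:E)%E.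
  rewrite /configs_event /config_prob -sumEFin.
  have [//] : measurable (configs_event A) /\
    (Pr (configs_event A) <= \sum_(c | A c) (\prod_j fine (P (Lam (c j))))%:E)%E.
  rewrite /configs_event; elim/big_rec2: _ => [|c x y Ac [my xy]].
    by rewrite measure0.
  have mc := measurable_config_event c; split; first exact: measurableU.
  apply: (le_trans (measureU2 _ mc my)).
  by rewrite -config_event_prob; exact: leeD2l.
rewrite EFinB leeBlDr // -(probability_setT Pr) -cover.
apply: (le_trans (measureU2 _ (measurable_configs_event _) (measurable_configs_event _))).
by apply: leeD => //; exact: le_sum.
Qed.

Lemma occ_config_event c w i : config_event c w ->
  fine (empirical_measure R (fun j => xi j w) (Lam i)) = (occ c i)%:R / n%:R.
Proof.
move=> hc; have cell j : Lam (c j) (xi j w) by apply: hc => /=; rewrite inE.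
rewrite /empirical_measure (eq_bigr (fun j => ((c j == i)%:R)%:E)); last first.
  by move=> j _; rewrite diracE (mem_partition hLam _ (cell j)).
by rewrite sumEFin -EFinM /= -natr_sum mulrC.
Qed.

End SampleConfigurations.

(** * Rates on typical configurations *)

Section Rates.
Variable R : realType.

(** [9 / 25] is [(3 / 5) ^+ 2], with [3 / 5 <= 2 / 3] as required by
    [occ_upper_tail] and [(1 - 3 / 5) ^+ 2 >= 1 / 10] as required by
    [phi_remainder]. *)
Lemma sqrt3_sub_sqrt2_le : Num.sqrt 3 - Num.sqrt 2 <= 9 / 25 :> R.
Proof.
have s3 : Num.sqrt 3 <= 7 / 4 :> R.
  rewrite -(@ler_pXn2r _ 2) ?nnegrE ?sqrtr_ge0 ?divr_ge0 // sqr_sqrtr //; lra.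
have s2 : 7 / 5 <= Num.sqrt 2 :> R.
  rewrite -(@ler_pXn2r _ 2) ?nnegrE ?sqrtr_ge0 ?divr_ge0 // sqr_sqrtr //; lra.
lra.
Qed.

End Rates.

Section TypicalBounds.
Variables (R : realType) (D n : nat) (p : 'I_D -> R) (alpha ALam : R).
Hypotheses (n0 : (0 < n)%N) (D0 : (0 < D)%N) (alpha0 : 0 < alpha) (A0 : 0 < ALam).
Hypotheses (p0 : forall i, 0 < p i) (p1 : \sum_i p i = 1).
Hypothesis p_ge : forall i, ALam <= D%:R * p i.
Hypothesis dev_small : forall i, cell_dev n p alpha i <= 3 / 5.
Local Notation L := (ln n.+1%:R : R).

Definition cell_const : R := 3 * Num.sqrt ((alpha + 1) / ALam).

Definition pearson_const : R := (4 + upper_tail_const R) * Num.sqrt (alpha + 3) +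
  32 * upper_tail_const R * (alpha + 3).

Definition rate_const : R := 26 * cell_const + 53 * pearson_const.

Let L_gt0 : 0 < L. Proof. by rewrite ln_gt0 // ltr1n. Qed.
Let nR : 0 < n%:R :> R. Proof. by rewrite ltr0n. Qed.
Let DR : 0 < D%:R :> R. Proof. by rewrite ltr0n. Qed.

Lemma cell_const_gt0 : 0 < cell_const.
Proof. by rewrite mulr_gt0 // sqrtr_gt0 divr_gt0 // addr_gt0. Qed.

Lemma pearson_const_ge0 : 0 <= pearson_const.
Proof.
have u0 := upper_tail_const_ge0 R; have a3 : 0 <= alpha + 3 by rewrite addr_ge0 ?ltW.
apply: addr_ge0; first by apply: mulr_ge0; [exact: addr_ge0|exact: sqrtr_ge0].
by apply: mulr_ge0 => //; exact: mulr_ge0.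
Qed.

Lemma rate_const_gt0 : 0 < rate_const.
Proof. by have := cell_const_gt0; have := pearson_const_ge0; rewrite /rate_const; lra. Qed.

(** Since [p i >= ALam / D], the relative deviations of the cell counts are of
    order [sqrt (D * L / n)], the first term of both rates. *)
Lemma cell_dev_le i :
  3 * cell_dev n p alpha i <= cell_const * Num.sqrt (D%:R * L / n%:R).
Proof.
rewrite /cell_const -[leRHS]mulrA ler_pM2l // -sqrtrM; last first.
  by rewrite divr_ge0 ?(ltW A0) // addr_ge0 // ltW.
apply: ler_wsqrtr.
rewrite ler_pdivrMr ?mulr_gt0 //.
have -> : (alpha + 1) / ALam * (D%:R * L / n%:R) * (n%:R * p i) =
    (alpha + 1) * L * (D%:R * p i / ALam) by field; rewrite !gt_eqF.
rewrite ler_peMr //; first by rewrite mulr_ge0 ?(ltW L_gt0) // addr_ge0 // ltW.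
by rewrite ler_pdivlMr // mul1r.
Qed.

Let sqrt_Dx (b : R) : 0 <= b ->
  Num.sqrt (D%:R * (b * L)) = D%:R * (Num.sqrt b * Num.sqrt (L / D%:R)).
Proof.
have DE : D%:R = Num.sqrt (D%:R ^+ 2) :> R by rewrite sqrtr_sqr ger0_norm.
move=> b0; rewrite -sqrtrM // [X in _ = X * _]DE -sqrtrM ?sqr_ge0 //.
by congr Num.sqrt; field; rewrite gt_eqF.
Qed.

Variable c : {ffun 'I_n -> 'I_D}.
Hypothesis typ : typical p alpha c.

Let q i : R := (occ c i)%:R / n%:R.

Let sum_q : \sum_i q i = 1.
Proof.
rewrite -mulr_suml -natr_sum /occ exchange_big /=.
rewrite (eq_bigr (fun=> 1%N)) => [|j _]; last first.
  rewrite (bigD1 (c j)) //= eqxx big1 // => i.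
  by rewrite eq_sym => /negbTE ->.
by rewrite sum1_card card_ord mulfV // gt_eqF.
Qed.

Let chi2E : chi2 p q = pearson_stat p c / n%:R.
Proof.
rewrite /chi2 /pearson_stat mulr_suml; apply: eq_bigr => i _.
by rewrite /q /pearson_term; field; rewrite !gt_eqF.
Qed.

Let pq_near i : p i / 10 <= q i /\ `|q i - p i| <= 3 * cell_dev n p alpha i * p i.
Proof.
have /andP[cells _] := typ.
have [lo near] := cells_typical_near n0 p0 dev_small i cells.
split; first by rewrite /q ler_pdivlMr //; lra.
have -> : q i - p i = ((occ c i)%:R - n%:R * p i) / n%:R.
  by rewrite /q; field; rewrite gt_eqF.
rewrite normrM normfV (gtr0_norm nR) ler_pdivrMr //; lra.
Qed.

Lemma typical_KL_sandwich : let m := D%:R / (2 * n%:R) in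
  ((1 - rate_const * eps_minus R n D) * m <= discrete_KL p q /\
   discrete_KL p q <= (1 + rate_const * eps_plus R n D) * m) /\
  ((1 - rate_const * eps_minus R n D) * m <= discrete_KL q p /\
   discrete_KL q p <= (1 + rate_const * eps_plus R n D) * m).
Proof.
move=> m.
set e1 : R := Num.sqrt (D%:R * L / n%:R).
set e2 : R := Num.sqrt (L / D%:R).
have em1 : e1 <= eps_minus R n D by rewrite /eps_minus le_max lexx.
have em2 : e2 <= eps_minus R n D by rewrite /eps_minus le_max lexx orbT.
have ep2 : e2 <= eps_plus R n D by rewrite /eps_plus !le_max lexx !orbT.
have ep3 : L / D%:R <= eps_plus R n D by rewrite /eps_plus !le_max lexx !orbT.
have emp : eps_minus R n D <= eps_plus R n D.
  by rewrite /eps_minus /eps_plus ge_max !le_max !lexx !orbT.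
have e10 : 0 <= e1 by exact: sqrtr_ge0.
have em0 := le_trans e10 em1.
have a0 := ltW cell_const_gt0; have b0 := pearson_const_ge0.
(* the relative deviations are bounded both by 2 and by the rate *)
pose dl := Num.min 2 (cell_const * e1).
have dl0 : 0 <= dl by rewrite le_min ler0n mulr_ge0.
have dl2 : dl <= 2 by rewrite ge_min lexx.
have dla : dl <= cell_const * eps_minus R n D.
  by apply: (@le_trans _ _ (cell_const * e1)); rewrite ?ge_min ?lexx ?orbT ?ler_wpM2l.
have m0 : 0 <= m by rewrite divr_ge0 // mulr_ge0.
have q0 i : 0 < q i.
  by have [h _] := pq_near i; apply: lt_le_trans h; rewrite divr_gt0.
have q_ge i : p i / 10 <= q i by have [] := pq_near i.
have q_near i : `|q i - p i| <= dl * p i.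
  have [_ h] := pq_near i; apply: (le_trans h); rewrite ler_pM2r // le_min.
  by rewrite cell_dev_le andbT; have := dev_small i; lra.
have /andP[_ /andP[Tlo Tup]] := typ.
have a3 : 0 <= alpha + 3 by rewrite addr_ge0 // ltW.
have u0 := upper_tail_const_ge0 R.
rewrite !(sqrt_Dx a3) -/e2 in Tlo Tup.
have s0 := sqrtr_ge0 (alpha + 3).
have XE : chi2 p q / 2 = pearson_stat p c / D%:R * m.
  by rewrite chi2E /m; field; rewrite !gt_eqF.
have Xlo : (1 - pearson_const * eps_minus R n D) * m <= chi2 p q / 2.
  rewrite XE ler_wpM2r // ler_pdivlMr //; apply: ltW; apply: le_lt_trans Tlo.
  have h1 : Num.sqrt (alpha + 3) * e2 <= Num.sqrt (alpha + 3) * eps_minus R n D.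
    by rewrite ler_wpM2l.
  have h2 : 4 * Num.sqrt (alpha + 3) * eps_minus R n D <= pearson_const * eps_minus R n D.
    rewrite ler_wpM2r // /pearson_const.
    have : 0 <= upper_tail_const R * Num.sqrt (alpha + 3) by rewrite mulr_ge0.
    have : 0 <= 32 * upper_tail_const R * (alpha + 3) by rewrite mulr_ge0 // mulr_ge0.
    by lra.
  have h3 : 4 * (Num.sqrt (alpha + 3) * e2) <= pearson_const * eps_minus R n D by lra.
  have := ler_wpM2l (ltW DR) h3; lra.
have Xup : chi2 p q / 2 <= (1 + pearson_const * eps_plus R n D) * m.
  rewrite XE ler_wpM2r // ler_pdivrMr //; apply: ltW; apply: (lt_le_trans Tup).
  have -> : 32 * upper_tail_const R * ((alpha + 3) * L) =
      D%:R * (32 * upper_tail_const R * (alpha + 3) * (L / D%:R)) by field; rewrite gt_eqF.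
  have us0 : 0 <= upper_tail_const R * Num.sqrt (alpha + 3) by rewrite mulr_ge0.
  have u3 : 0 <= 32 * upper_tail_const R * (alpha + 3) by rewrite mulr_ge0 // mulr_ge0.
  have h1 := ler_wpM2l us0 ep2.
  have h2 := ler_wpM2l u3 ep3.
  have ep0 := le_trans em0 emp.
  have h4 : 0 <= 4 * Num.sqrt (alpha + 3) * eps_plus R n D by rewrite mulr_ge0 ?mulr_ge0.
  have h3 : upper_tail_const R * Num.sqrt (alpha + 3) * e2 +
      32 * upper_tail_const R * (alpha + 3) * (L / D%:R) <= pearson_const * eps_plus R n D.
    by rewrite /pearson_const; lra.
  have := ler_wpM2l (ltW DR) h3; lra.
split.
  apply: (KL_sandwich m0 _ dl0 dl2 a0 b0 em0 emp dla (erefl _) _ Xlo Xup).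
    exact: (KL_pq_ge0 p0 p1 sum_q q_ge).
  exact: (KL_pq_chi2 p0 p1 sum_q q_ge dl2 q_near).
apply: (KL_sandwich m0 _ dl0 dl2 a0 b0 em0 emp dla (erefl _) _ Xlo Xup).
  exact: (KL_qp_ge0 p0 p1 sum_q q_ge).
exact: (KL_qp_chi2 p0 p1 sum_q q_ge dl2 q_near).
Qed.

End TypicalBounds.

(** * The concentration inequality *)

Lemma partition_sum_prob (d : measure_display) (Z : measurableType d) (R : realType)
    (mu P : probability Z R) (D : nat) (Lam : 'I_D -> set Z) :
  histogram_partition mu Lam -> \sum_i fine (P (Lam i)) = 1.
Proof.
move=> hLam; have [[_ tri _] mLam _] := hLam.
have cov : [set: Z] = \big[setU/set0]_(i < D) Lam i.
  apply/esym/seteqP; split => // x _; have [i hi] := partition_cell hLam x.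
  by rewrite (bigD1 i) //=; left.
apply: EFin_inj; rewrite -(probability_setT P) cov measure_bigsetU_ord // -sumEFin.
by apply: eq_bigr => i _; rewrite fineK // fin_num_measure.
Qed.

Lemma ln_natS_ge (R : realType) (n : nat) : (0 < n)%N -> 2^-1 <= ln n.+1%:R :> R.
Proof.
move=> n0; apply: (@le_trans _ _ (ln 2)); last first.
  by rewrite ler_ln ?posrE ?ltr0n // ler_nat.
have : ln (1 + - 2^-1) <= - 2^-1 :> R by apply: le_ln1Dx; lra.
have -> : 1 + - 2^-1 = 2^-1 :> R by field.
by rewrite lnV ?posrE // lerN2.
Qed.

Theorem theorem3p1 (R : realType) (alpha Aplus ALam : R)
    (halpha : 0 < alpha) (hAplus : 0 < Aplus) (hALam : 0 < ALam)
    (htau : (alpha + 1) * Aplus / ALam <= Num.sqrt 3 - Num.sqrt 2) :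
  exists2 A0 : R, 0 < A0 &
  forall (Aminus : R) (hAminus : 0 < Aminus)
    (d : measure_display) (Z : measurableType d) (mu P : probability Z R)
    (fstar : Z -> R)
    (hS : densities_S mu P fstar)
    (hdens : forall A : set Z, measurable A -> P A = density_measure mu fstar A)
    (dO : measure_display) (Omega : measurableType dO) (Pr : probability Omega R)
    (n : nat) (hn : (1 <= n)%N)
    (xi : 'I_n -> {mfun Omega >-> Z}) (hxi : iid_sample Pr P xi)
    (D : nat) (Lam : 'I_D -> set Z) (hLam : histogram_partition mu Lam)
    (hD1 : (1 < D)%N)
    (hDn : D%:R <= Aplus * n%:R / ln n.+1%:R)
    (hnn : Aplus * n%:R / ln n.+1%:R <= n%:R)
    (hinf : ALam <= D%:R * inf [set fine (P (Lam i)) | i in [set: 'I_D]]),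
  exists E : set Omega,
    [/\ measurable E,
        ((1 - 4 * n.+1%:R `^ (- alpha))%:E <= Pr E)%E &
        forall w, E w ->
          let fm := KL_projection mu P Lam in
          let fhat := histogram_MLE mu (fun i => xi i w) Lam in
          let lower := (1 - A0 * eps_minus R n D) * (D%:R / (2 * n%:R)) in
          let upper := (1 + A0 * eps_plus R n D) * (D%:R / (2 * n%:R)) in
          (lower%:E <= KL mu fm fhat <= upper%:E)%E /\
          (lower%:E <= KL mu fhat fm <= upper%:E)%E].
Proof.
exists (rate_const alpha ALam); first exact: rate_const_gt0.
move=> _ _ d Z mu P _ _ _ dO Omega Pr n n0 xi hxi D Lam hLam D1 hDn hnn hinf.
pose p i := fine (P (Lam i)).
have D0 : (0 < D)%N by exact: ltnW.
have DR : 0 < D%:R :> R by rewrite ltr0n.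
have nR : 0 < n%:R :> R by rewrite ltr0n.
have L2 := ln_natS_ge R n0; set L : R := ln n.+1%:R in hDn hnn L2.
have L0 : 0 < L by lra.
have Dn : (D <= n)%N by rewrite -(ler_nat R); exact: le_trans hDn hnn.
have p_ge i : ALam <= D%:R * p i.
  apply: (le_trans hinf); rewrite ler_pM2l //; apply: ge_inf; last by exists i.
  by exists 0 => _ [j _ <-]; rewrite fine_ge0.
have p0 i : 0 < p i by rewrite -(pmulr_rgt0 _ DR); exact: lt_le_trans (p_ge i).
have p1 : \sum_i p i = 1 by exact: partition_sum_prob hLam.
have lam0 i : 0 < n%:R * p i by rewrite mulr_gt0.
have dev2 i : (alpha + 1) * L / (n%:R * p i) <= 9 / 25.
  apply: le_trans (sqrt3_sub_sqrt2_le R); apply: le_trans htau.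
  have DL : D%:R * L <= Aplus * n%:R by rewrite -ler_pdivlMr.
  rewrite ler_pdivrMr // -!mulrA ler_pM2l ?addr_gt0 //.
  have -> : Aplus * (ALam^-1 * (n%:R * p i)) = Aplus * n%:R * p i / ALam by ring.
  rewrite ler_pdivlMr //; apply: (@le_trans _ _ (L * (D%:R * p i))).
    by rewrite ler_pM2l.
  by rewrite mulrA [L * _]mulrC ler_pM2r.
have dev_small i : cell_dev n p alpha i <= 3 / 5.
  have -> : 3 / 5 = Num.sqrt (9 / 25) :> R.
    by rewrite (_ : 9 / 25 = (3 / 5) ^+ 2 :> R) ?sqrtr_sqr ?ger0_norm //; field.
  by apply: ler_wsqrtr.
have lam1 i : 1 <= n%:R * p i.
  have aL : 0 <= alpha * L by rewrite mulr_ge0 ?ltW.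
  by have := dev2 i; rewrite ler_pdivrMr //; lra.
exists (configs_event xi Lam (typical p alpha)); split.
- exact: measurable_configs_event hLam _.
- apply: le_trans (configs_event_ge hxi hLam _); rewrite lee_fin lerB //.
  exact: atypical_prob.
move=> w /configs_eventP[c tc wc] fm fhat lower upper.
pose q i : R := (occ c i)%:R / n%:R.
have q0 i : 0 < q i.
  have /andP[cells _] := tc.
  have [h _] := cells_typical_near n0 p0 dev_small i cells.
  by rewrite divr_gt0 //; apply: lt_le_trans h; rewrite divr_gt0.
have phat i : fine (empirical_measure R (fun j => xi j w) (Lam i)) = q i.
  by rewrite (occ_config_event hLam i wc).
have [[l1 u1] [l2 u2]] := typical_KL_sandwich n0 D0 halpha hALam p0 p1 p_ge dev_small tc.
rewrite /fm /fhat /KL_projection /histogram_MLE.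
rewrite (KL_histogram_of hLam (p := p) (q := q)) //.
rewrite (KL_histogram_of hLam (p := q) (q := p)) //.
by rewrite !lee_fin l1 u1 l2 u2.
Qed.
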